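(* For any integer $\gamma \geq 0$, the operad $\mathsf{Dup}_\gamma$ is Koszul and, for any integer $n \geq 1$, $\mathsf{Dup}_\gamma(n)$ is (isomorphic to) the vector space of $\gamma$-edge valued binary trees with $n$ internal nodes.
   Context: The ground field has characteristic zero; operad means nonsymmetric operad; $[\gamma] = \{1, \dots, \gamma\}$; $a \downarrow a' := \min(a, a')$. $\mathsf{Dup}_\gamma$ is the operad presented by binary generators $\hookleftarrow_a, \hookrightarrow_a$, $a \in [\gamma]$, and the space of relations generated, for all $a, a' \in [\gamma]$, by $\hookleftarrow_a \circ_1 \hookrightarrow_{a'} - \hookrightarrow_{a'} \circ_2 \hookleftarrow_a$; $\hookleftarrow_a \circ_1 \hookleftarrow_{a'} - \hookleftarrow_{a \downarrow a'} \circ_2 \hookleftarrow_a$; $\hookrightarrow_{a \downarrow a'} \circ_1 \hookrightarrow_a - \hookrightarrow_a \circ_2 \hookrightarrow_{a'}$. That is, it is the quotient of the free operad on these generators by the operad ideal generated by these elements. A $\gamma$-edge valued binary tree is a planar binary tree (each internal node has exactly two children) with at least one internal node in which every edge connecting two internal nodes is labeled by an element of $[\gamma]$. A quadratic operad is Koszul if its Koszul complex is acyclic (Ginzburg–Kapranov). *)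

(* Defs.v *)
(* [boolp] is used to turn the propositions "x lies in every subspace such that
   ..." into boolean predicates, so that one can quotient by them. *)
From HB Require Import structures.
From mathcomp Require Import all_boot all_order all_algebra.
From mathcomp Require Import boolp zify.

Set Implicit Arguments.
Unset Strict Implicit.
Unset Printing Implicit Defensive.

Import GRing.Theory.
Local Open Scope ring_scope.
Local Open Scope quotient_scope.

(* [A] labels the internal nodes, [L] decorates the leaves. *)
Inductive btree (A L : Type) : Type :=
| Leaf of L
| Node of A & btree A L & btree A L.
Arguments Leaf {A L}.
Arguments Node {A L}.

Fixpoint nodes A L (t : btree A L) : nat :=
  if t is Node _ l r then (nodes l + nodes r).+1 else 0.

Fixpoint arity A L (w : L -> nat) (t : btree A L) : nat :=
  match t with
  | Leaf x => w x
  | Node _ l r => arity w l + arity w r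
  end.

Section BtreeChoice.
Variables (A L : choiceType).

Fixpoint btree_enc (t : btree A L) : GenTree.tree (A + L) :=
  match t with
  | Leaf x => GenTree.Leaf (inr x)
  | Node a l r => GenTree.Node 0 [:: GenTree.Leaf (inl a); btree_enc l; btree_enc r]
  end.

Fixpoint btree_dec (t : GenTree.tree (A + L)) : option (btree A L) :=
  match t with
  | GenTree.Leaf (inr x) => Some (Leaf x)
  | GenTree.Node _ [:: GenTree.Leaf (inl a); l; r] =>
      if btree_dec l is Some l' then
        if btree_dec r is Some r' then Some (Node a l' r') else None
      else None
  | _ => None
  end.

Lemma btree_encK : pcancel btree_enc btree_dec.
Proof. by elim=> //= a l -> r ->. Qed.

HB.instance Definition _ := Choice.copy (btree A L) (pcan_type btree_encK).
End BtreeChoice.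

HB.instance Definition _ (A L : countType) :=
  Countable.copy (btree A L) (pcan_type (@btree_encK A L)).

Fixpoint btree_enum (A L : Type) (sA : seq A) (sL : seq L) (h : nat) :
    seq (btree A L) :=
  [seq Leaf x | x <- sL] ++
  (if h is h'.+1 then
     flatten [seq [seq Node a p.1 p.2 |
               p <- [seq (l, r) | l <- btree_enum sA sL h',
                                  r <- btree_enum sA sL h']] | a <- sA]
   else [::]).

Section BtreeEnum.
Variables (A : finType) (L : choiceType).

Fixpoint all_leaves (P : pred L) (t : btree A L) : bool :=
  match t with
  | Leaf x => P x
  | Node _ l r => all_leaves P l && all_leaves P r
  end.

Lemma mem_btree_enum (sL : seq L) h t :
  all_leaves (mem sL) t -> (nodes t <= h)%N -> t \in btree_enum (enum A) sL h.
Proof.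
elim: h t => [|h IHh] [x|a l r] //=; rewrite mem_cat.
- by move=> xs _; rewrite map_f.
- by move=> xs _; rewrite map_f.
move=> /andP[Pl Pr]; rewrite ltnS => le_h; apply/orP; right.
apply/flattenP; exists [seq Node a p.1 p.2 |
  p <- [seq (l, r) | l <- btree_enum (enum A) sL h,
                     r <- btree_enum (enum A) sL h]].
  by apply: (map_f (fun a => _)); rewrite mem_enum.
apply/mapP; exists (l, r) => //; apply: allpairs_f; apply: IHh => //.
  exact: leq_trans (leq_addr _ _) le_h.
exact: leq_trans (leq_addl _ _) le_h.
Qed.

Lemma nodes_lt_arity (w : L -> nat) (t : btree A L) :
  (forall x, 0 < w x)%N -> (nodes t < arity w t)%N.
Proof.
move=> w_gt0; elim: t => [x|a l IHl r IHr] //=.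
by rewrite -addnS -addSn leq_add.
Qed.

Lemma all_leaves_le (w : L -> nat) (t : btree A L) n :
  (arity w t <= n)%N -> all_leaves (fun x => w x <= n)%N t.
Proof.
elim: t => [x|a l IHl r IHr] //= le_n; apply/andP; split.
  exact/IHl/(leq_trans (leq_addr _ _) le_n).
exact/IHr/(leq_trans (leq_addl _ _) le_n).
Qed.

Lemma sub_all_leaves (P Q : pred L) (t : btree A L) :
  subpred P Q -> all_leaves P t -> all_leaves Q t.
Proof.
move=> PQ; elim: t => [x|a l IHl r IHr] /=; first exact: PQ.
by case/andP=> /IHl-> /IHr->.
Qed.
End BtreeEnum.

Section SubEnum.
Variables (T : choiceType) (P : pred T) (sT : subChoiceType P) (e : seq T).
Hypothesis eP : forall x, P x -> x \in e.

Lemma sub_enumP : Finite.axiom (undup (pmap (insub : T -> option sT) e)).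
Proof.
move=> u; rewrite count_uniq_mem ?undup_uniq // mem_undup mem_pmap.
by rewrite -(valK u) map_f // eP // (valP u).
Qed.
End SubEnum.

(* Trees whose leaves are bare. *)
Definition ftree (A : Type) := btree A unit.
HB.instance Definition _ (A : choiceType) := Choice.on (ftree A).
HB.instance Definition _ (A : countType) := Countable.on (ftree A).

Notation Lf := (Leaf tt).

Definition leaves A (t : ftree A) : nat := arity (fun=> 1%N) t.

Record ntree (A : Type) (n : nat) :=
  NTree {tree_of :> ftree A; tree_ofP : leaves tree_of == n}.
HB.instance Definition _ A n := [isSub for @tree_of A n].
HB.instance Definition _ (A : choiceType) n := [Choice of ntree A n by <:].
HB.instance Definition _ (A : countType) n := [Countable of ntree A n by <:].

Lemma ftree_enumP (A : finType) n (t : ftree A) :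
  (leaves t <= n)%N -> t \in btree_enum (enum A) [:: tt] n.
Proof.
move=> le_n; apply: mem_btree_enum.
  by elim: {le_n} t => [[]|_ l IHl r IHr] //=; apply/andP.
by apply/(leq_trans _ le_n)/ltnW/nodes_lt_arity.
Qed.

Lemma ntree_enumP (A : finType) n (t : ftree A) :
  leaves t == n -> t \in btree_enum (enum A) [:: tt] n.
Proof. by move=> /eqP<-; exact: ftree_enumP. Qed.

HB.instance Definition _ (A : finType) n :=
  isFinite.Build (ntree A n) (@sub_enumP _ _ (ntree A n) _ (@ntree_enumP A n)).

(* Leaves are numbered from 1, from left to right. *)
Fixpoint graft A (i : nat) (s t : ftree A) : ftree A :=
  match s with
  | Leaf _ => t
  | Node a l r => if (i <= leaves l)%N then Node a (graft i l t) r
                  else Node a l (graft (i - leaves l) r t)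
  end.

(* Number of internal nodes of [s] visited after its leaf [i] in the preorder
   (root, left subtree, right subtree) traversal. *)
Fixpoint nodes_after A (i : nat) (s : ftree A) : nat :=
  match s with
  | Leaf _ => 0
  | Node _ l r => if (i <= leaves l)%N then nodes_after i l + nodes r
                  else nodes_after (i - leaves l) r
  end.

Section Span.
Variables (K : fieldType) (V : vectType K) (S : V -> Prop).

Definition spanp : {pred V} :=
  fun x => `[< forall U : {vspace V}, (forall s, S s -> s \in U) -> x \in U >].

Lemma spanp_submod_closed : submod_closed spanp.
Proof.
split=> [|a x y]; first by apply/asboolP => U _; exact: mem0v.
move=> /asboolP Sx /asboolP Sy; apply/asboolP => U SU.
by rewrite memvD ?memvZ ?Sx ?Sy.
Qed.
End Span.

Section QuotMod.
Variables (K : nzRingType) (V : lmodType K) (S : {pred V}).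

Definition quotmod_pred of submod_closed S := S.

Variable modS : submod_closed S.

HB.instance Definition _ :=
  GRing.isSubmodClosed.Build K V (quotmod_pred modS) modS.

Definition quotmod : Type := Quotient.quot (quotmod_pred modS).
HB.instance Definition _ := GRing.Zmodule.on quotmod.
HB.instance Definition _ :
  EqQuotient V (Quotient.equiv (quotmod_pred modS)) quotmod := EqQuotient.on quotmod.

Definition quot_scale (a : K) (x : quotmod) : quotmod :=
  \pi_quotmod (a *: repr x).

Lemma quot_eqP (x y : V) :
  reflect (\pi_quotmod x = \pi_quotmod y) (x - y \in S).
Proof. by rewrite (Quotient.idealrBE (quotmod_pred modS) x y); exact: eqP. Qed.

Lemma quot_piD x y : \pi_quotmod (x + y) = \pi_quotmod x + \pi_quotmod y.
Proof. exact: (raddfD (\pi_(Quotient.quot (quotmod_pred modS)))). Qed.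

Lemma quot_scaleE a x : quot_scale a (\pi_quotmod x) = \pi_quotmod (a *: x).
Proof.
apply/quot_eqP; rewrite -scalerBr (@rpredZ _ _ (quotmod_pred modS)) //.
by apply/quot_eqP; rewrite reprK.
Qed.

Fact quot_scaleA a b x : quot_scale a (quot_scale b x) = quot_scale (a * b) x.
Proof. by elim/quotW: x => x; rewrite (quot_scaleE b) !quot_scaleE scalerA. Qed.
Fact quot_scale1 : left_id 1 quot_scale.
Proof. by elim/quotW=> x; rewrite quot_scaleE scale1r. Qed.
Fact quot_scaleDr : right_distributive quot_scale +%R.
Proof.
move=> a; elim/quotW=> x; elim/quotW=> y.
by rewrite -quot_piD !quot_scaleE scalerDr quot_piD.
Qed.
Fact quot_scaleDl x : {morph quot_scale^~ x : a b / a + b}.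
Proof.
by move=> a b /=; elim/quotW: x => x; rewrite !quot_scaleE scalerDl quot_piD.
Qed.

HB.instance Definition _ := GRing.Zmodule_isLmodule.Build K quotmod
  quot_scaleA quot_scale1 quot_scaleDr quot_scaleDl.

Definition quot_pi (x : V) : quotmod := \pi_quotmod x.

Fact quot_pi_linear : linear quot_pi.
Proof. by move=> a x y; rewrite /quot_pi quot_piD -quot_scaleE. Qed.
HB.instance Definition _ := GRing.isLinear.Build K V quotmod *:%R quot_pi quot_pi_linear.

Lemma quot_pi_eq0 x : (quot_pi x == 0) = (x \in S).
Proof. by rewrite -(raddf0 quot_pi) -[in RHS](subr0 x); apply/eqP/quot_eqP. Qed.
End QuotMod.
Arguments quot_pi {K V S} modS.

Section BasisVector.
Variables (K : fieldType) (T : choiceType) (P : pred T) (sT : subFinType P).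

(* The basis vector indexed by [t], or 0 when [t] does not satisfy [P]. *)
Definition bvec (t : T) : {ffun sT -> K^o} := [ffun u : sT => (val u == t)%:R : K^o].

(* The coordinate of [x] along [t], or 0 when [t] does not satisfy [P]. *)
Definition coef (x : {ffun sT -> K^o}) (t : T) : K :=
  if insub t is Some u then x u else 0.
End BasisVector.
Arguments bvec {K T P} sT t.

Section Operads.
Variables (K : fieldType) (E : finType).

(* The arity [n] component of the free nonsymmetric operad on the set [E] of
   binary generators: a tree stands for the composite of its node labels, the
   children of a node being the inputs of the corresponding generator. *)
Definition Free (n : nat) := {ffun ntree E n -> K^o}.
HB.instance Definition _ n := Vector.on (Free n).

Definition fvec n (t : ftree E) : Free n := bvec (ntree E n) t.

Definition corolla (e : E) : Free 2 := fvec 2 (Node e Lf Lf).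

Definition pcomp m n (i : nat) (x : Free m) (y : Free n) : Free (m + n).-1 :=
  \sum_(s : ntree E m) \sum_(t : ntree E n)
     (x s * y t) *: fvec _ (graft i s t).

Record operad_ideal (I : forall n, {vspace Free n}) : Prop := OperadIdeal {
  operad_ideal_l : forall m n i (x : Free m) (y : Free n),
    (1 <= i <= m)%N -> x \in I m -> pcomp i x y \in I (m + n).-1;
  operad_ideal_r : forall m n i (x : Free m) (y : Free n),
    (1 <= i <= m)%N -> y \in I n -> pcomp i x y \in I (m + n).-1 }.

(* In what follows, [R] is a space of quadratic relations. *)
Definition gen_ideal (R : {vspace Free 3}) n : {pred Free n} :=
  fun x => `[< forall I : (forall n, {vspace Free n}),
                 operad_ideal I -> (R <= I 3)%VS -> x \in I n >].

Lemma gen_ideal_submod_closed R n : submod_closed (gen_ideal R (n := n)).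
Proof.
split=> [|a x y]; first by apply/asboolP => I _ _; exact: mem0v.
move=> /asboolP Ix /asboolP Iy; apply/asboolP => I idI RI.
by rewrite memvD ?memvZ ?Ix ?Iy.
Qed.

(* The arity [n] component of the operad presented by [E] and [R]. *)
Definition presented (R : {vspace Free 3}) (n : nat) : Type :=
  quotmod (gen_ideal_submod_closed R n).
HB.instance Definition _ R n := GRing.Lmodule.on (presented R n).

(* The cofree conilpotent cooperad on the suspension of [E] has [Free n] as its
   arity [n] component, placed in degree [n - 1]: every internal node has degree
   1 and a tree represents the tensor product of its nodes in preorder.  Its
   infinitesimal decomposition is dual to grafting; cutting [graft i s t] into
   [s] and [t] moves the nodes of [t] past the nodes of [s] that follow leaf [i],
   which produces the sign [cut_sign].  The (i, m, n) component of the
   decomposition of [x] is the tensor in [Free m (x) Free n] whose matrix has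
   the vectors [cut_top] as rows and [cut_bot] as columns. *)
Definition cut_sign (i : nat) (s t : ftree E) : K :=
  (-1) ^+ (nodes t * nodes_after i s).

Definition cut_top p n (i : nat) (x : Free p) (s : ftree E) : Free n :=
  [ffun t : ntree E n => cut_sign i s t * coef x (graft i s t) : K^o].

Definition cut_bot p m (i : nat) (x : Free p) (t : ftree E) : Free m :=
  [ffun s : ntree E m => cut_sign i s t * coef x (graft i s t) : K^o].

(* A tensor lies in [C m (x) C n] if and only if the rows of its matrix lie in
   [C n] and its columns lie in [C m]. *)
Record subcooperad (C : forall n, {vspace Free n}) : Prop := SubCooperad {
  subcooperad_top : forall m n i (x : Free (m + n).-1) (s : ntree E m),
    (1 <= i <= m)%N -> x \in C (m + n).-1 -> cut_top n i x s \in C n;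
  subcooperad_bot : forall m n i (x : Free (m + n).-1) (t : ntree E n),
    (1 <= i <= m)%N -> x \in C (m + n).-1 -> cut_bot m i x t \in C m }.

(* The largest subcooperad of the cofree cooperad on the suspension of [E]
   whose weight 2 component is contained in the double suspension of [R]. *)
Definition koszul_dual (R : {vspace Free 3}) n (x : Free n) : Prop :=
  exists C : forall n, {vspace Free n},
    [/\ subcooperad C, (C 3 <= R)%VS & x \in C n].

(* A two-level tree: a lower tree whose leaves are decorated by upper trees. *)
Definition ctree := btree E (ftree E).
HB.instance Definition _ := Countable.on ctree.

(* [k] lower internal nodes (hence [k + 1] upper trees), total arity [n]. *)
Record nctree (k n : nat) := NCTree {
  ctree_of :> ctree;
  ctree_ofP : (nodes ctree_of == k) && (arity (@leaves E) ctree_of == n) }.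
HB.instance Definition _ k n := [isSub for @ctree_of k n].
HB.instance Definition _ k n := [Countable of nctree k n by <:].

Lemma nctree_enumP k n (c : ctree) :
  (nodes c == k) && (arity (@leaves E) c == n) ->
  c \in btree_enum (enum E) (btree_enum (enum E) [:: tt] n) k.
Proof.
case/andP=> /eqP<- /eqP<-; apply: mem_btree_enum => //.
apply: sub_all_leaves (all_leaves_le (leqnn _)) => t /=.
exact: ftree_enumP.
Qed.
HB.instance Definition _ k n :=
  isFinite.Build (nctree k n) (@sub_enumP _ _ (nctree k n) _ (@nctree_enumP k n)).

(* The component of arity [n] and weight [k] in the left factor of the composite
   product of the cofree cooperad with the free operad. *)
Definition Free2 (k n : nat) := {ffun nctree k n -> K^o}.
HB.instance Definition _ k n := Vector.on (Free2 k n).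

Definition cvec k n (c : ctree) : Free2 k n := bvec (nctree k n) c.

(* The two-level tree with lower tree [t] and upper trees [ps]. *)
Fixpoint plug (t : ftree E) (ps : seq (ftree E)) : ctree :=
  match t with
  | Leaf _ => Leaf (head Lf ps)
  | Node e l r => Node e (plug l (take (leaves l) ps)) (plug r (drop (leaves l) ps))
  end.

(* The tensor (z; ps1, y, ps2). *)
Definition ctensor k n m (z : Free k.+1) (ps1 : seq (ftree E)) (y : Free m)
    (ps2 : seq (ftree E)) : Free2 k n :=
  \sum_(t : ntree E k.+1) \sum_(q : ntree E m)
    (z t * y q) *: cvec k n (plug t (ps1 ++ (q : ftree E) :: ps2)).

Inductive ideal_tensor (R : {vspace Free 3}) k n : Free2 k n -> Prop :=
  IdealTensor m z ps1 (y : Free m) ps2 :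
    (size ps1 + size ps2)%N = k -> y \in gen_ideal R (n := m) ->
    ideal_tensor R (ctensor n z ps1 y ps2).

Inductive dual_tensor (R : {vspace Free 3}) k n : Free2 k n -> Prop :=
  DualTensor m z ps1 (y : Free m) ps2 :
    (size ps1 + size ps2)%N = k -> koszul_dual R z ->
    dual_tensor R (ctensor n z ps1 y ps2).

(* The composite product of the cofree cooperad with the presented operad: the
   kernel of the projection of a tensor product of spaces onto the tensor product
   of their quotients is spanned by the tensors with one factor in the kernel. *)
Definition CofreeP (R : {vspace Free 3}) (k n : nat) : Type :=
  quotmod (spanp_submod_closed (@ideal_tensor R k n)).
HB.instance Definition _ R k n := GRing.Lmodule.on (CofreeP R k n).

Definition cpi R k n (x : Free2 k n) : CofreeP R k n :=
  quot_pi (spanp_submod_closed (@ideal_tensor R k n)) x.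

(* The underlying space of the Koszul complex: the composite product of the
   Koszul dual cooperad with the presented operad, in homological degree [k]. *)
Definition koszul_space R k n (x : CofreeP R k n) : Prop :=
  exists2 y : Free2 k n, y \in spanp (@dual_tensor R k n) & x = cpi R y.

(* The terms of the Koszul differential, as pairs (j, c'): a lower node both of
   whose children are upper trees is detached from the lower tree and composed,
   as a generator of the operad, with these two upper trees; [j] is the number
   of lower nodes that precede it in preorder.  The Koszul sign is (-1)^j: the
   node is first moved past the lower nodes that follow it, and the degree -1
   twisting morphism is then applied past all the other lower nodes. *)
Fixpoint kterms (c : ctree) : seq (nat * ctree) :=
  match c with
  | Leaf _ => [::]
  | Node e l r =>
      (if (l, r) is (Leaf p, Leaf q) then [:: (0%N, Leaf (Node e p q))] else [::])
      ++ [seq (v.1.+1, Node e v.2 r) | v <- kterms l]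
      ++ [seq ((nodes l + v.1).+1, Node e l v.2) | v <- kterms r]
  end.

Definition kdiff0 k n (x : Free2 k.+1 n) : Free2 k n :=
  \sum_(c : nctree k.+1 n)
     x c *: \sum_(v <- kterms c) (-1) ^+ v.1 *: cvec k n v.2.

(* The map induced by [kdiff0]; see [kdiffE] below. *)
Definition kdiff R k n (x : CofreeP R k.+1 n) : CofreeP R k n :=
  cpi R (kdiff0 (repr x)).

Section KdiffE.

Lemma spanp_gen (V : vectType K) (S : V -> Prop) x : S x -> x \in spanp S.
Proof. by move=> Sx; apply/asboolP => U; apply. Qed.

Lemma spanp_lin (V W : vectType K) (S : V -> Prop) (T : W -> Prop)
    (f : {linear V -> W}) :
  (forall x, S x -> f x \in spanp T) -> forall x, x \in spanp S -> f x \in spanp T.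
Proof.
move=> fS x /asboolP Sx; apply/asboolP => U TU.
have: x \in (linfun f @^-1: U)%VS.
  by apply: Sx => s /fS/asboolP/(_ U TU); rewrite -memv_preim lfunE.
by rewrite -memv_preim lfunE.
Qed.

Lemma spanpD (V : vectType K) (S : V -> Prop) x y :
  x \in spanp S -> y \in spanp S -> x + y \in spanp S.
Proof. by move=> Sx Sy; rewrite -[x]scale1r; apply: (spanp_submod_closed S).2. Qed.

Lemma spanpZ (V : vectType K) (S : V -> Prop) a x :
  x \in spanp S -> a *: x \in spanp S.
Proof.
move=> Sx; rewrite -[_ *: x]addr0; apply: (spanp_submod_closed S).2 => //.
exact: (spanp_submod_closed S).1.
Qed.

Lemma spanp_sum (V : vectType K) (S : V -> Prop) (I : Type) (r : seq I) (F : I -> V) :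
  (forall i, F i \in spanp S) -> \sum_(i <- r) F i \in spanp S.
Proof.
move=> FS; elim/big_ind: _ => // [|x y]; last exact: spanpD.
exact: (spanp_submod_closed S).1.
Qed.

Lemma sum_bvec (T : choiceType) (P : pred T) (sT : subFinType P) (V : lmodType K)
    (f : T -> V) (t : T) :
  P t -> \sum_(u : sT) (bvec sT t u : K) *: f (val u) = f t.
Proof.
move=> Pt; rewrite (bigD1 (Sub t Pt)) //= big1 => [|u ne_ut].
  by rewrite ffunE SubK eqxx scale1r addr0.
rewrite ffunE; case: eqP => [ut|]; last by rewrite scale0r.
by case/eqP: ne_ut; apply: val_inj; rewrite SubK.
Qed.

Lemma bvec0 (T : choiceType) (P : pred T) (sT : subFinType P) (t : T) :
  ~~ P t -> bvec sT t = 0 :> {ffun sT -> K^o}.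
Proof.
move=> nPt; apply/ffunP => u; rewrite !ffunE; case: eqP => // ut.
by rewrite -ut (valP u) in nPt.
Qed.

Lemma kterms_nodes (c : ctree) v : v \in kterms c ->
  (nodes v.2).+1 = nodes c /\ arity (@leaves E) v.2 = arity (@leaves E) c.
Proof.
elim: c v => [//|e l IHl r IHr] v /=; rewrite !mem_cat => /or3P[].
- case: l {IHl} => // p; case: r {IHr} => // q.
  by rewrite inE => /eqP-> /=; split.
- by case/mapP=> w /IHl[<- <-] -> /=.
- by case/mapP=> w /IHr[<- <-] -> /=; rewrite addnS.
Qed.

Definition kbasis k n (c : ctree) : Free2 k n :=
  \sum_(v <- kterms c) (-1) ^+ v.1 *: cvec k n v.2.

Fact kdiff0_is_linear k n : linear (@kdiff0 k n).
Proof.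
move=> a x y; rewrite /kdiff0 scaler_sumr -big_split; apply: eq_bigr => c _ /=.
by rewrite !ffunE scalerDl scalerA.
Qed.
HB.instance Definition _ k n :=
  GRing.isLinear.Build K (Free2 k.+1 n) (Free2 k n) *:%R (@kdiff0 k n)
    (@kdiff0_is_linear k n).

Lemma kdiff0_cvec k n c : kdiff0 (cvec k.+1 n c) = kbasis k n c.
Proof.
have [Pc|nPc] := boolP ((nodes c == k.+1) && (arity (@leaves E) c == n)).
  exact: (sum_bvec (nctree k.+1 n) (kbasis k n) Pc).
rewrite /cvec bvec0 // linear0 /kbasis big_seq big1 // => v /kterms_nodes[nv av].
rewrite /cvec bvec0 ?scaler0 //; apply: contra nPc.
by rewrite -nv -av eqSS.
Qed.

(* Two-level trees with a hole in place of one upper tree. *)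
Inductive cctx := Hole | CtxL of E & cctx & ctree | CtxR of E & ctree & cctx.

Fixpoint fill (C : cctx) (q : ftree E) : ctree :=
  match C with
  | Hole => Leaf q
  | CtxL e C c => Node e (fill C q) c
  | CtxR e c C => Node e c (fill C q)
  end.

Lemma plug_fill (t : ftree E) ps1 ps2 : (size ps1 + size ps2).+1 = leaves t ->
  exists C, forall q, plug t (ps1 ++ q :: ps2) = fill C q.
Proof.
rewrite /leaves; elim: t ps1 ps2 => [x|e l IHl r IHr] ps1 ps2 /=.
  by case: ps1 => //; exists Hole.
rewrite -!/(leaves _) in IHl IHr *; move=> sz.
have [lt_l|le_l] := ltnP (size ps1) (leaves l).
  have [|C fC] := IHl ps1 (take (leaves l - (size ps1).+1) ps2).
    by rewrite size_takel -?addSn ?subnKC // leq_subLR; lia.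
  exists (CtxL e C (plug r (drop (leaves l - (size ps1).+1) ps2))) => q /=.
  have Dl : (leaves l - size ps1 = (leaves l - (size ps1).+1).+1)%N by lia.
  by rewrite take_cat drop_cat ltnNge ltnW //= Dl /= fC.
have [|C fC] := IHr (drop (leaves l) ps1) ps2; first by rewrite size_drop; lia.
exists (CtxR e (plug l (take (leaves l) ps1)) C) => q /=.
rewrite take_cat drop_cat -fC; case: ltnP le_l => // ge_l le_l.
have -> : leaves l = size ps1 by apply/eqP; rewrite eqn_leq le_l ge_l.
by rewrite subnn take0 drop0 take_size drop_size cats0.
Qed.

Lemma leavesN e (l r : ftree E) : leaves (Node e l r) = (leaves l + leaves r)%N.
Proof. by []. Qed.

Lemma leavesLf : leaves (Lf : ftree E) = 1%N.
Proof. by []. Qed.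

Lemma leaves_nodes (t : ftree E) : leaves t = (nodes t).+1.
Proof. by elim: t => //= e l IHl r IHr; rewrite /leaves /= -!/(leaves _) IHl IHr addnS. Qed.

Lemma nodes_plug (t : ftree E) ps : size ps = leaves t -> nodes (plug t ps) = nodes t.
Proof.
elim: t ps => //= e l IHl r IHr ps; rewrite leavesN => szp.
rewrite IHl ?IHr // ?size_drop ?szp ?addKn //.
by rewrite size_takel // szp leq_addr.
Qed.

Fixpoint skel (c : ctree) : ftree E :=
  if c is Node e l r then Node e (skel l) (skel r) else Lf.
Fixpoint tops (c : ctree) : seq (ftree E) :=
  match c with Leaf p => [:: p] | Node _ l r => tops l ++ tops r end.

Lemma size_tops c : size (tops c) = leaves (skel c).
Proof. by elim: c => //= e l IHl r IHr; rewrite size_cat IHl IHr. Qed.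

Lemma plug_skel c : plug (skel c) (tops c) = c.
Proof.
elim: c => //= e l IHl r IHr.
by rewrite -size_tops take_size_cat // drop_size_cat // IHl IHr.
Qed.

Lemma fill_plug C : exists t ps1 ps2,
  (size ps1 + size ps2).+1 = leaves t /\
  forall q, fill C q = plug t (ps1 ++ q :: ps2).
Proof.
have [ps1 [ps2 [t tC]]] : exists ps1 ps2 t,
    forall q, tops (fill C q) = ps1 ++ q :: ps2 /\ skel (fill C q) = t.
  elim: C => [|e C [ps1 [ps2 [t tC]]] c|e c C [ps1 [ps2 [t tC]]]] /=.
  - by exists [::], [::], Lf.
  - exists ps1, (ps2 ++ tops c), (Node e t (skel c)) => q.
    by have [-> ->] := tC q; rewrite -catA.
  - exists (tops c ++ ps1), ps2, (Node e (skel c) t) => q.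
    by have [-> ->] := tC q; rewrite catA.
exists t, ps1, ps2; split=> [|q].
  by have [tf <-] := tC Lf; rewrite -size_tops tf size_cat /= addnS.
by have [<- <-] := tC q; rewrite plug_skel.
Qed.

Fixpoint cterms (C : cctx) : seq (nat * (cctx * (ftree E -> ftree E))) :=
  match C with
  | Hole => [::]
  | CtxL e C c =>
      (if (C, c) is (Hole, Leaf p) then [:: (0%N, (Hole, Node e ^~ p))] else [::])
      ++ [seq (v.1.+1, (CtxL e v.2.1 c, v.2.2)) | v <- cterms C]
      ++ [seq ((nodes (fill C Lf) + v.1).+1, (CtxL e C v.2, id)) | v <- kterms c]
  | CtxR e c C =>
      (if (c, C) is (Leaf p, Hole) then [:: (0%N, (Hole, Node e p))] else [::])
      ++ [seq (v.1.+1, (CtxR e v.2 C, id)) | v <- kterms c]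
      ++ [seq ((nodes c + v.1).+1, (CtxR e c v.2.1, v.2.2)) | v <- cterms C]
  end.

Lemma nodes_fill C q q' : nodes (fill C q) = nodes (fill C q').
Proof. by elim: C => //= [e C -> c|e c C ->]. Qed.

Lemma kterms_fill C q :
  kterms (fill C q) = [seq (v.1, fill v.2.1 (v.2.2 q)) | v <- cterms C].
Proof.
elim: C => //= [e C IH c|e c C IH]; rewrite !map_cat -!map_comp IH -!map_comp.
- rewrite (nodes_fill C q Lf); congr (_ ++ _).
  by case: C {IH} => [|? ? ?|? ? ?]; case: c.
- by congr (_ ++ _); case: c; case: C {IH}.
Qed.

Definition ideal_stable R (h : ftree E -> ftree E) :=
  forall m (y : Free m), y \in gen_ideal R (n := m) ->
  exists m' (y' : Free m'), y' \in gen_ideal R (n := m') /\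
    forall (V : lmodType K) (f : ftree E -> V),
      \sum_(q : ntree E m) (y q : K) *: f (h q) =
      \sum_(q : ntree E m') (y' q : K) *: f q.

Lemma ideal_stable_graft R (s : ftree E) i : (1 <= i <= leaves s)%N ->
    (forall q : ftree E, leaves (graft i s q) = (leaves s + leaves q).-1) ->
  ideal_stable R (graft i s).
Proof.
move=> i_s ls m y Iy; exists _, (pcomp i (fvec (leaves s) s) y); split.
  apply/asboolP => I idI RI; apply: operad_ideal_r => //.
  by move/asboolP: Iy; apply.
have Dp : pcomp i (fvec (leaves s) s) y =
    \sum_(q : ntree E m) y q *: fvec (leaves s + m).-1 (graft i s q).
  rewrite /pcomp; transitivity (\sum_(u : ntree E (leaves s))
      (fvec (leaves s) s u : K) *:
        \sum_(q : ntree E m) y q *: fvec (leaves s + m).-1 (graft i u q)).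
    by apply: eq_bigr => u _; rewrite scaler_sumr; apply: eq_bigr => q _; rewrite scalerA.
  exact: (sum_bvec (ntree E (leaves s))
    (fun u => \sum_(q : ntree E m) y q *: fvec (leaves s + m).-1 (graft i u q))).
move=> V f; rewrite Dp; under [RHS]eq_bigr => u _.
  rewrite sum_ffunE scaler_suml.
  under eq_bigr => q _ do rewrite ffunE -scalerA.
  over.
rewrite exchange_big /=; apply: eq_bigr => q _.
rewrite -scaler_sumr; congr (_ *: _).
rewrite (sum_bvec (ntree E (leaves s + m).-1) f) //.
by rewrite ls (eqP (tree_ofP q)).
Qed.

Lemma cterms_stable R C v :
  List.In v (cterms C) -> ideal_stable R v.2.2.
Proof.
have st_id : ideal_stable R id by move=> m y Iy; exists m, y.
have inP T1 T2 (g : T1 -> T2) s y : List.In y (map g s) ->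
  exists2 x, List.In x s & y = g x.
  elim: s => //= x s IH [<-|/IH[z]]; first by exists x; auto.
  by exists z; auto.
have inD T1 (s1 s2 : seq T1) y : List.In y (s1 ++ s2) ->
    List.In y s1 \/ List.In y s2.
  by elim: s1 => [|x s1 IH] /=; [right | case=> [|/IH[]]; auto].
elim: C v => [//|e C IH c|e c C IH] v /= /(inD _ _ _ _)[|/(inD _ _ _ _)[]].
- case: C {IH} => [|? ? ?|? ? ?] //; case: c => //= p [<-|//] /=.
  apply: (ideal_stable_graft (s := Node e Lf p) (i := 1)) => [|q] //.
  have -> : graft 1 (Node e Lf p) q = Node e q p by [].
  by rewrite !leavesN leavesLf add1n addSn /= addnC.
- by case/(inP _ _ _ _ _)=> w /IH st_w ->.
- by case/(inP _ _ _ _ _)=> w _ ->.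
- case: c => // p; case: C {IH} => //= -[<-|//] /=.
  have Dg q : graft (leaves p).+1 (Node e p Lf) q = Node e p q.
    by rewrite /= ltnn.
  move=> m y Iy; have [||m' [y' [Iy' Dy']]] :=
    @ideal_stable_graft R (Node e p Lf) (leaves p).+1 _ _ m y Iy.
  + by rewrite leavesN leavesLf addn1 leqnn.
  + by move=> q; rewrite Dg !leavesN leavesLf addn1.
  exists m', y'; split=> // V f; rewrite -Dy'; apply: eq_bigr => q _.
  by rewrite Dg.
- by case/(inP _ _ _ _ _)=> w _ ->.
- by case/(inP _ _ _ _ _)=> w /IH st_w ->.
Qed.

Lemma fill_ideal R k n m (y : Free m) C : y \in gen_ideal R (n := m) ->
  \sum_(q : ntree E m) (y q : K) *: cvec k n (fill C q)
    \in spanp (@ideal_tensor R k n).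
Proof.
move=> Iy; have [t [ps1 [ps2 [sz fC]]]] := fill_plug C.
under eq_bigr => q _ do rewrite fC.
have [szk|szk] := eqVneq (size ps1 + size ps2)%N k; last first.
  rewrite big1 => [|q _]; first exact: (spanp_submod_closed _).1.
  rewrite /cvec bvec0 ?scaler0 //; apply: contra szk => /andP[/eqP<- _].
  by rewrite nodes_plug ?size_cat ?addnS // -eqSS sz leaves_nodes.
have lt : leaves t == k.+1 by rewrite -sz szk.
apply: spanp_gen.
suff ->: \sum_(q : ntree E m) (y q : K) *: cvec k n (plug t (ps1 ++ (q : ftree E) :: ps2))
   = ctensor n (fvec k.+1 t) ps1 y ps2 by apply: IdealTensor.
rewrite /ctensor; under [RHS]eq_bigr => u _.
  under eq_bigr => q _ do rewrite -scalerA.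
  rewrite -scaler_sumr; over.
by rewrite (sum_bvec (ntree E k.+1) (fun u => \sum_(q : ntree E m)
   (y q : K) *: cvec k n (plug u (ps1 ++ (q : ftree E) :: ps2)))).
Qed.

Lemma kdiff0_ideal R k n (x : Free2 k.+1 n) :
  x \in spanp (@ideal_tensor R k.+1 n) -> kdiff0 x \in spanp (@ideal_tensor R k n).
Proof.
apply: (spanp_lin (f := @kdiff0 k n)) => x' [m z ps1 y ps2 sz Iy {x x'}].
rewrite /ctensor linear_sum; apply: spanp_sum => t /=.
under eq_bigr => q _ do rewrite -scalerA.
rewrite -scaler_sumr linearZ; apply: spanpZ.
have [|C fC] := @plug_fill t ps1 ps2; first by rewrite sz (eqP (tree_ofP t)).
rewrite linear_sum; under eq_bigr => q _.
  rewrite linearZ /= kdiff0_cvec /kbasis fC kterms_fill big_map.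
  rewrite scaler_sumr; under eq_bigr => v _ do rewrite scalerA mulrC -scalerA.
  over.
rewrite exchange_big /=.
have: forall v, List.In v (cterms C) -> ideal_stable R v.2.2 by exact: cterms_stable.
elim: (cterms C) => [|v s IHs] st_s.
  by rewrite big_nil; exact: (spanp_submod_closed _).1.
rewrite big_cons; apply: spanpD; last by apply: IHs => w sw; apply: st_s; right.
rewrite -scaler_sumr; apply: spanpZ.
have [m' [y' [Iy' Dy']]] := st_s v (or_introl erefl) m y Iy.
by rewrite (Dy' _ (fun q => cvec k n (fill v.2.1 q))) fill_ideal.
Qed.

End KdiffE.

Lemma kdiffE R k n (x : Free2 k.+1 n) : kdiff (cpi R x) = cpi R (kdiff0 x).
Proof.
apply/quot_eqP; rewrite -linearB; apply: kdiff0_ideal.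
by apply/(quot_eqP (spanp_submod_closed _)); exact: reprK (cpi R x).
Qed.

Definition koszul_cycle R k n : CofreeP R k n -> Prop :=
  if k is k'.+1 then fun x : CofreeP R k'.+1 n => kdiff x = 0 else fun=> True.

(* Acyclicity of the Koszul complex: its homology is that of the unit operad.  In
   arity 1 the complex is always [K] placed in degree 0 (all generators have
   arity 2), so that the condition bears on the other arities. *)
Definition koszul (R : {vspace Free 3}) : Prop :=
  forall (n k : nat) (x : CofreeP R k n), n != 1%N ->
    koszul_space x -> koszul_cycle x ->
    exists2 y : CofreeP R k.+1 n, koszul_space y & kdiff y = x.

End Operads.

(* The label set {1, ..., gamma} is represented by ['I_gamma], and the generators
   "hook left a", "hook right a" by [inl a], [inr a]. *)
Definition dup_gen (gamma : nat) : Type := ('I_gamma + 'I_gamma)%type.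
HB.instance Definition _ gamma := Finite.on (dup_gen gamma).

Section Dup.
Variables (K : fieldType) (gamma : nat).

Definition hookl (a : 'I_gamma) : Free K (dup_gen gamma) 2 := corolla K (inl a).
Definition hookr (a : 'I_gamma) : Free K (dup_gen gamma) 2 := corolla K (inr a).

Local Notation "x ∘_1 y" := (pcomp 1 x y : Free _ _ 3) (at level 40).
Local Notation "x ∘_2 y" := (pcomp 2 x y : Free _ _ 3) (at level 40).
Local Notation "a ↓ b" := (Order.min a b) (at level 35).

Definition dup_relations : seq (Free K (dup_gen gamma) 3) :=
  [seq hookl a ∘_1 hookr a' - hookr a' ∘_2 hookl a
     | a <- enum 'I_gamma, a' <- enum 'I_gamma] ++
  [seq hookl a ∘_1 hookl a' - hookl (a ↓ a') ∘_2 hookl a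
     | a <- enum 'I_gamma, a' <- enum 'I_gamma] ++
  [seq hookr (a ↓ a') ∘_1 hookr a - hookr a ∘_2 hookr a'
     | a <- enum 'I_gamma, a' <- enum 'I_gamma].

Definition dup_rel : {vspace Free K (dup_gen gamma) 3} := <<dup_relations>>%VS.

Definition Dup (n : nat) : Type := presented dup_rel n.
HB.instance Definition _ n := GRing.Lmodule.on (Dup n).
End Dup.

(* The root node with its left and right children: [None] is a leaf, and
   [Some (a, t)] an edge labeled by [a] to the root node of [t]. *)
Inductive evtree (gamma : nat) : Type :=
  EVNode of option ('I_gamma * evtree gamma) & option ('I_gamma * evtree gamma).

Fixpoint ev_nodes gamma (t : evtree gamma) : nat :=
  let: EVNode l r := t in
  ((if l is Some (_, u) then ev_nodes u else 0) +
   (if r is Some (_, u) then ev_nodes u else 0)).+1.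

Section EvFinite.
Variable gamma : nat.

Fixpoint ev_enc (t : evtree gamma) : ftree 'I_gamma * ftree 'I_gamma :=
  let: EVNode l r := t in
  (if l is Some (a, u) then Node a (ev_enc u).1 (ev_enc u).2 else Lf,
   if r is Some (a, u) then Node a (ev_enc u).1 (ev_enc u).2 else Lf).

Fixpoint ev_dec_edge (t : ftree 'I_gamma) : option ('I_gamma * evtree gamma) :=
  if t is Node a l r then Some (a, EVNode (ev_dec_edge l) (ev_dec_edge r)) else None.

Definition ev_dec (p : ftree 'I_gamma * ftree 'I_gamma) : evtree gamma :=
  EVNode (ev_dec_edge p.1) (ev_dec_edge p.2).

Lemma ev_encK : cancel ev_enc ev_dec.
Proof.
rewrite /cancel; fix IH 1 => -[l r]; rewrite /ev_dec /=; congr EVNode.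
- case: l => [[a u]|] //=; congr (Some (_, _)); exact: IH u.
- case: r => [[a u]|] //=; congr (Some (_, _)); exact: IH u.
Qed.

HB.instance Definition _ := Countable.copy (evtree gamma) (can_type ev_encK).

Lemma ev_nodes_enc t :
  ev_nodes t = (nodes (ev_enc t).1 + nodes (ev_enc t).2).+1.
Proof.
move: t; fix IH 1 => -[l r] /=; congr (_ + _).+1.
- case: l => [[a u]|] //=; exact: IH u.
- case: r => [[a u]|] //=; exact: IH u.
Qed.
End EvFinite.

Record nevtree (gamma n : nat) :=
  NEvtree {evtree_of :> evtree gamma; evtree_ofP : ev_nodes evtree_of == n}.
HB.instance Definition _ gamma n := [isSub for @evtree_of gamma n].
HB.instance Definition _ gamma n := [Countable of nevtree gamma n by <:].

Lemma nevtree_enumP gamma n (t : evtree gamma) : ev_nodes t == n ->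
  t \in [seq ev_dec (l, r) | l <- btree_enum (enum 'I_gamma) [:: tt] n,
                             r <- btree_enum (enum 'I_gamma) [:: tt] n].
Proof.
have all_tt (u : ftree 'I_gamma) : all_leaves (mem [:: tt]) u.
  by elim: u => [[]|_ l IHl r IHr] //=; apply/andP.
rewrite ev_nodes_enc => /eqP<-; apply/allpairsP; exists (ev_enc t).
split; last by rewrite /= -surjective_pairing ev_encK.
  by apply: mem_btree_enum => //; rewrite -addnS leq_addr.
by apply: mem_btree_enum => //; rewrite -addSn leq_addl.
Qed.
HB.instance Definition _ gamma n :=
  isFinite.Build (nevtree gamma n)
    (@sub_enumP _ _ (nevtree gamma n) _ (@nevtree_enumP gamma n)).

(* The vector space with basis the edge valued binary trees with [n] nodes. *)
Definition EvSpace (K : fieldType) (gamma n : nat) := {ffun nevtree gamma n -> K^o}.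
HB.instance Definition _ K gamma n := Vector.on (EvSpace K gamma n).

(* Main.v *)
(* Orienting (x r_a y) l_b z -> x r_a (y l_b z), (x l_a y) l_b z -> x l_min(a,b) (y l_b z)
   and x r_a (y r_b z) -> (x r_a y) r_min(a,b) z, the normal forms are the leaf |
   and the trees u r_b v and | l_a w with v not rooted at an r.  These are in
   bijection with the edge valued trees, on which the two kinds of operations have
   recursive definitions that satisfy the relations.

   The Koszul dual cooperad has in arity k + 1 a basis indexed by the words
   r_b1 ... r_bj l_a1 ... l_ai with i + j = k; the basis element of a word is the
   signed sum of the trees obtained by merging its letters in all possible orders.
   The Koszul complex then has as basis the sequences x_0 s_1 x_1 ... s_k x_k with
   s_1 ... s_k such a word and the x_i normal forms, and its differential is the
   alternating sum of the merges of x_(i-1) s_i x_i.  An explicit contraction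
   undoes one merge: if x is the normal form between the last r and the first l,
   it splits x = u r_c v into u, r_c, v; when there is no r in the word it also
   splits x = | l_c v.  It fails only on the unit, in arity 1. *)
Require Import Defs.
From HB Require Import structures.
From mathcomp Require Import all_boot all_order all_algebra.
From mathcomp Require Import boolp zify ring.

Set Implicit Arguments.
Unset Strict Implicit.
Unset Printing Implicit Defensive.

Import GRing.Theory.
Local Open Scope ring_scope.
Local Open Scope quotient_scope.

(** * Evaluation of trees in the free algebra *)

Section Evtree.
Variable gamma : nat.
Implicit Types (a b : 'I_gamma) (x y z : evtree gamma).

(** The Koszul dual is a union of unspecified subcooperads, so it needs two bounds. From below, the
    word sums span a subcooperad, because cutting such a sum gives a single tensor: contracted word
    times block. From above, an element of any subcooperad with weight 2 part in the relations is
    determined by its coefficients on one comb per word: any other tree contains a two-node piece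
    that is no left-hand side, and the relations, read in context, express its coefficient through
    those of trees of smaller polynomial weight. Preorder signs depend on whole trees; rescaling
    coefficients by [(-1) ^+ sg t] leaves signs that depend on positions and sizes only, and
    alternating ones in the differential. The complex is made of subspaces of quotients. All maps
    are thus defined on free two-level trees and compared modulo the ideal: [omega_map] sends words
    to dual tensors, [psi_map] goes back by reading combs, and the contraction lives on words. With
    labels forgotten, [lop] and [rop] graft one tree at the rightmost or leftmost leaf of the other:
    the two products of the free duplicial algebra on one generator. *)

Lemma evtree_nested_ind (P : evtree gamma -> Prop) :
    (forall L R, (forall a u, L = Some (a, u) -> P u) ->
                 (forall a u, R = Some (a, u) -> P u) -> P (EVNode L R)) ->
  forall x, P x.
Proof.
move=> Pnode; fix IH 1 => -[L R]; apply: Pnode => a u.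
- by case: L => [[b v]|]; [have Pv := IH v => -[_ <-]; exact: Pv | discriminate].
- by case: R => [[b v]|]; [have Pv := IH v => -[_ <-]; exact: Pv | discriminate].
Qed.

(** The value of a bare leaf, hence the operadic unit: nodes of an edge valued tree count inputs,
    and edges count generators. *)
Definition ev1 : evtree gamma := EVNode None None.

(* [EVNode (Some (b, u)) R] stands for the normal form [u r_b v] with
   [v = EVNode None R], and [EVNode None (Some (a, w))] for [| l_a w]. *)
Fixpoint lop a x y : evtree gamma :=
  let: EVNode L R := x in
  EVNode L (Some (if R is Some (b, w) then (Order.min a b, lop a w y) else (a, y))).

Fixpoint rop a x y : evtree gamma :=
  let: EVNode L R := y in
  EVNode (Some (if L is Some (b, u) then (Order.min a b, rop a x u) else (a, x))) R.

Lemma lop_rop a b x y z : lop a (rop b x y) z = rop b x (lop a y z).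
Proof. by case: y => [[[]|] ?]. Qed.

Lemma lop_lop a b x y z : lop a (lop b x y) z = lop (Order.min a b) x (lop a y z).
Proof.
elim/evtree_nested_ind: x => L [[c w]|] _ IH //=.
by rewrite (IH _ _ erefl) Order.TotalTheory.minA.
Qed.

Lemma rop_rop a b x y z : rop (Order.min a b) (rop a x y) z = rop a x (rop b y z).
Proof.
elim/evtree_nested_ind: z => [[[c w]|]] R IH _ //=.
by rewrite (IH _ _ erefl) Order.TotalTheory.minA.
Qed.

Lemma ev_nodes_lop a x y : ev_nodes (lop a x y) = (ev_nodes x + ev_nodes y)%N.
Proof.
elim/evtree_nested_ind: x => L [[c w]|] _ IH /=; last by lia.
by rewrite (IH _ _ erefl); lia.
Qed.

Lemma ev_nodes_rop a x y : ev_nodes (rop a x y) = (ev_nodes x + ev_nodes y)%N.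
Proof.
elim/evtree_nested_ind: y => [[[c w]|]] R IH _ /=; last by lia.
by rewrite (IH _ _ erefl); lia.
Qed.

Definition act (e : dup_gen gamma) x y : evtree gamma :=
  match e with inl a => lop a x y | inr a => rop a x y end.

Lemma ev_nodes_act e x y : ev_nodes (act e x y) = (ev_nodes x + ev_nodes y)%N.
Proof. by case: e => a; rewrite (ev_nodes_lop, ev_nodes_rop). Qed.

Fixpoint eval (t : ftree (dup_gen gamma)) : evtree gamma :=
  if t is Node e l r then act e (eval l) (eval r) else ev1.

Fixpoint reify x : ftree (dup_gen gamma) :=
  let: EVNode L R := x in
  let v := if R is Some (a, w) then Node (inl a) Lf (reify w) else Lf in
  if L is Some (b, u) then Node (inr b) (reify u) v else v.

Lemma reifyK : cancel reify eval.
Proof.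
elim/evtree_nested_ind => L R IHL IHR /=.
by case: L R IHL IHR => [[b u]|] [[a w]|] IHL IHR //=;
  rewrite ?(IHL _ _ erefl) ?(IHR _ _ erefl).
Qed.

Lemma ev_nodes_eval t : ev_nodes (eval t) = leaves t.
Proof. by elim: t => //= e l IHl r IHr; rewrite ev_nodes_act IHl IHr. Qed.

Lemma leaves_reify x : leaves (reify x) = ev_nodes x.
Proof. by rewrite -ev_nodes_eval reifyK. Qed.

(** Each relation is a difference of two trees, so the ideal can be handled through a congruence on
    trees instead of on vectors. *)
Inductive dcong : ftree (dup_gen gamma) -> ftree (dup_gen gamma) -> Prop :=
| dcong_refl t : dcong t t
| dcong_sym t u : dcong t u -> dcong u t
| dcong_trans t u v : dcong t u -> dcong u v -> dcong t v
| dcong_node e t t' u u' : dcong t t' -> dcong u u' -> dcong (Node e t u) (Node e t' u')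
| dcong_lr a b t u v :
    dcong (Node (inl a) (Node (inr b) t u) v) (Node (inr b) t (Node (inl a) u v))
| dcong_ll a b t u v :
    dcong (Node (inl a) (Node (inl b) t u) v)
          (Node (inl (Order.min a b)) t (Node (inl a) u v))
| dcong_rr a b t u v :
    dcong (Node (inr (Order.min a b)) (Node (inr a) t u) v)
          (Node (inr a) t (Node (inr b) u v)).

Lemma dcong_eval t u : dcong t u -> eval t = eval u.
Proof.
elim=> //= {t u}; do 1?[by move=> t u v _ -> _ ->].
- by move=> e t t' u u' _ -> _ ->.
- by move=> a b t u v; rewrite lop_rop.
- by move=> a b t u v; rewrite lop_lop.
- by move=> a b t u v; rewrite rop_rop.
Qed.

Lemma dcong_leaves t u : dcong t u -> leaves t = leaves u.
Proof. by move/dcong_eval; rewrite -!ev_nodes_eval => ->. Qed.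

Lemma dcong_lop a x y : dcong (Node (inl a) (reify x) (reify y)) (reify (lop a x y)).
Proof.
elim/evtree_nested_ind: x => L R _ IH /=.
(* [v] is the normal form stripped of its root r; [dcong_lr] moves the product past that r, so the
   induction runs along the chain of l's only. *)
set v := (if R is Some _ then _ else _ : ftree _).
have cv : dcong (Node (inl a) v (reify y)) (reify (lop a (EVNode None R) y)).
  rewrite {}/v /=; case: R IH => [[b w]|] IH /=; last exact: dcong_refl.
  apply: dcong_trans (dcong_ll _ _ _ _ _) _.
  exact: dcong_node (dcong_refl _) (IH _ _ erefl).
case: L => [[b u]|//]; apply: dcong_trans (dcong_lr _ _ _ _ _) _.
exact: dcong_node (dcong_refl _) cv.
Qed.

Lemma dcong_rop a x y : dcong (Node (inr a) (reify x) (reify y)) (reify (rop a x y)).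
Proof.
elim/evtree_nested_ind: y => L R IH _ /=.
case: L IH => [[b u]|] IH /=; last exact: dcong_refl.
apply: dcong_trans (dcong_sym (dcong_rr _ _ _ _ _)) _.
exact: dcong_node (IH _ _ erefl) (dcong_refl _).
Qed.

Lemma dcong_nf t : dcong t (reify (eval t)).
Proof.
elim: t => [[]|e l IHl r IHr] /=; first exact: dcong_refl.
apply: dcong_trans (dcong_node _ IHl IHr) _.
by case: e => a; [exact: dcong_lop | exact: dcong_rop].
Qed.

(** The relations keep the order of the leaves, so leaf [i] falls in the same one of the three
    subtrees on both sides, and the same relation applies after grafting there. *)
Lemma dcong_graft i t u v : dcong t u -> dcong (graft i t v) (graft i u v).
Proof.
move=> tu; elim: tu i => {t u} /=.
- by move=> t i; exact: dcong_refl.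
- by move=> t u _ IH i; exact: dcong_sym.
- by move=> t u w _ IHt _ IHu i; exact: dcong_trans (IHt i) (IHu i).
- move=> e t t' u u' tt' IHt uu' IHu i; rewrite -(dcong_leaves tt').
  by case: ifP => _; apply: dcong_node.
- move=> a b t u w i; rewrite !leavesN /=.
  case: (leqP i (leaves t)) => it.
    by rewrite (leq_trans it (leq_addr _ _)); exact: dcong_lr.
  rewrite leq_subLR; case: ifP => _; first exact: dcong_lr.
  by rewrite subnDA; exact: dcong_lr.
- move=> a b t u w i; rewrite !leavesN /=.
  case: (leqP i (leaves t)) => it.
    by rewrite (leq_trans it (leq_addr _ _)); exact: dcong_ll.
  rewrite leq_subLR; case: ifP => _; first exact: dcong_ll.
  by rewrite subnDA; exact: dcong_ll.
- move=> a b t u w i; rewrite !leavesN /=.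
  case: (leqP i (leaves t)) => it.
    by rewrite (leq_trans it (leq_addr _ _)); exact: dcong_rr.
  rewrite leq_subLR; case: ifP => _; first exact: dcong_rr.
  by rewrite subnDA; exact: dcong_rr.
Qed.

End Evtree.

(** * Grafting and ideals in the free operad *)

Section TreeSizes.
Variable A : Type.
Implicit Types s t : ftree A.

Lemma succ_nodes t : leaves t = (nodes t).+1.
Proof.
elim: t => // e l IHl r IHr.
by rewrite -[LHS]/(leaves l + leaves r)%N IHl IHr addnS.
Qed.

Lemma leaves_gt0 t : (0 < leaves t)%N.
Proof. by rewrite succ_nodes. Qed.

Lemma nodes_graft i s t : nodes (graft i s t) = (nodes s + nodes t)%N.
Proof.
by elim: s i => [[]|e l IHl r IHr] i //=; case: ifP => _ /=; rewrite (IHl, IHr); lia.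
Qed.

Lemma leaves_graft i s t : leaves (graft i s t) = (leaves s + leaves t).-1.
Proof. by rewrite !succ_nodes nodes_graft addnS. Qed.
End TreeSizes.

Section FreeOperad.
Variables (K : fieldType) (E : finType).

Lemma pcomp_fvec m n i (s t : ftree E) : leaves s = m -> leaves t = n ->
  Defs.pcomp i (fvec K m s) (fvec K n t) = fvec K (m + n).-1 (graft i s t).
Proof.
move=> /eqP sm /eqP tn; rewrite /Defs.pcomp; under eq_bigr => u _.
  under eq_bigr => v _ do rewrite -scalerA.
  rewrite -scaler_sumr (sum_bvec (ntree E n) (fun v => fvec K (m + n).-1 (graft i u v))) //.
  over.
exact: (sum_bvec (ntree E m) (fun u => fvec K (m + n).-1 (graft i u t))).
Qed.

Lemma pcompBl m n i (x x' : Free K E m) (y : Free K E n) :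
  Defs.pcomp i (x - x') y = Defs.pcomp i x y - Defs.pcomp i x' y.
Proof.
rewrite /Defs.pcomp -sumrB; apply: eq_bigr => s _; rewrite -sumrB; apply: eq_bigr => t _.
by rewrite !ffunE mulrBl scalerBl.
Qed.

Lemma pcompBr m n i (x : Free K E m) (y y' : Free K E n) :
  Defs.pcomp i x (y - y') = Defs.pcomp i x y - Defs.pcomp i x y'.
Proof.
rewrite /Defs.pcomp -sumrB; apply: eq_bigr => s _; rewrite -sumrB; apply: eq_bigr => t _.
by rewrite !ffunE mulrBr scalerBl.
Qed.

Section Ideal.
Variables (I : forall n, {vspace Free K E n}) (idI : operad_ideal I).

Definition congr_mod (s t : ftree E) : Prop :=
  leaves s = leaves t /\ fvec K (leaves s) s - fvec K (leaves s) t \in I (leaves s).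

Lemma congr_mod_refl s : congr_mod s s.
Proof. by split=> //; rewrite subrr mem0v. Qed.

Lemma congr_mod_sym s t : congr_mod s t -> congr_mod t s.
Proof. by case=> st Ist; split=> //; rewrite -opprB memvN -st. Qed.

Lemma congr_mod_trans s t u : congr_mod s t -> congr_mod t u -> congr_mod s u.
Proof.
case=> st Ist [tu Itu]; split; first by rewrite st.
by rewrite -(subrKA (fvec K _ t)) memvD // st.
Qed.

Lemma congr_mod_graftl i s s' t : (1 <= i <= leaves s)%N ->
  congr_mod s s' -> congr_mod (graft i s t) (graft i s' t).
Proof.
move=> i_s [ss' Is]; rewrite /congr_mod !leaves_graft -ss'; split=> //.
rewrite -!pcomp_fvec // -pcompBl.
exact: (operad_ideal_l idI).
Qed.

Lemma congr_mod_graftr i s t t' : (1 <= i <= leaves s)%N ->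
  congr_mod t t' -> congr_mod (graft i s t) (graft i s t').
Proof.
move=> i_s [tt' It]; rewrite /congr_mod !leaves_graft -tt'; split=> //.
rewrite -!pcomp_fvec // -pcompBr.
exact: (operad_ideal_r idI).
Qed.

(** The subtrees are replaced one at a time, as grafts on the first leaf of [Node e Lf t] and on the
    last leaf of [Node e s' Lf]. *)
Lemma congr_mod_node e s s' t t' :
  congr_mod s s' -> congr_mod t t' -> congr_mod (Node e s t) (Node e s' t').
Proof.
move=> ss' tt'; apply: (@congr_mod_trans _ (Node e s' t)).
  have /= := @congr_mod_graftr 1 (Node e Lf t) s s'; apply=> //.
have := @congr_mod_graftr (leaves s').+1 (Node e s' Lf) t t'.
rewrite /= ltnn; apply=> //.
by rewrite leavesN leavesLf addn1 leqnn.
Qed.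

(** Grafting from the last leaf to the first keeps the numbers of the remaining leaves, so this
    yields the instances of a three-leaf relation at arbitrary subtrees. *)
Lemma congr_mod_graft3 s s' t u v : leaves s = 3%N -> congr_mod s s' ->
  congr_mod (graft 1 (graft 2 (graft 3 s v) u) t) (graft 1 (graft 2 (graft 3 s' v) u) t).
Proof.
move=> s3 ss'; have := leaves_gt0 v; have := leaves_gt0 u; move=> u0 v0.
do 3!(apply: congr_mod_graftl; first by rewrite ?leaves_graft s3; lia).
exact: ss'.
Qed.
End Ideal.
End FreeOperad.

(** * The ideal of relations and the isomorphism with edge valued trees *)

Section DupIdeal.
Variables (K : fieldType) (gamma : nat).
Local Notation E := (dup_gen gamma).

Lemma corolla2_1 (e f : E) :
  Defs.pcomp 1 (corolla K e) (corolla K f) = fvec K 3 (Node e (Node f Lf Lf) Lf).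
Proof. exact: pcomp_fvec. Qed.

Lemma corolla2_2 (e f : E) :
  Defs.pcomp 2 (corolla K e) (corolla K f) = fvec K 3 (Node e Lf (Node f Lf Lf)).
Proof. exact: pcomp_fvec. Qed.

Lemma dup_rel_lr (a b : 'I_gamma) :
  fvec K 3 (Node (inl a : E) (Node (inr b) Lf Lf) Lf) -
  fvec K 3 (Node (inr b : E) Lf (Node (inl a) Lf Lf)) \in dup_rel K gamma.
Proof.
rewrite -corolla2_1 -corolla2_2; apply: memv_span; rewrite !mem_cat.
by apply/orP; left; apply: allpairs_f; rewrite mem_enum.
Qed.

Lemma dup_rel_ll (a b : 'I_gamma) :
  fvec K 3 (Node (inl a : E) (Node (inl b) Lf Lf) Lf) -
  fvec K 3 (Node (inl (Order.min a b) : E) Lf (Node (inl a) Lf Lf)) \in dup_rel K gamma.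
Proof.
rewrite -corolla2_1 -corolla2_2; apply: memv_span; rewrite !mem_cat.
by apply/or3P; apply: Or32; apply: allpairs_f; rewrite mem_enum.
Qed.

Lemma dup_rel_rr (a b : 'I_gamma) :
  fvec K 3 (Node (inr (Order.min a b) : E) (Node (inr a) Lf Lf) Lf) -
  fvec K 3 (Node (inr a : E) Lf (Node (inr b) Lf Lf)) \in dup_rel K gamma.
Proof.
rewrite -corolla2_1 -corolla2_2; apply: memv_span; rewrite !mem_cat.
by apply/or3P; apply: Or33; apply: allpairs_f; rewrite mem_enum.
Qed.

Lemma dcong_congr_mod (I : forall n, {vspace Free K E n}) s t : operad_ideal I ->
  (dup_rel K gamma <= I 3)%VS -> dcong s t -> congr_mod I s t.
Proof.
move=> idI /subvP RI; elim=> {s t}.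
- by move=> t; exact: congr_mod_refl.
- by move=> s t _; exact: congr_mod_sym.
- by move=> s t u _ st _; exact: congr_mod_trans st.
- by move=> e s s' t t' _ ss' _; exact: congr_mod_node ss'.
- move=> a b t u v; apply: (congr_mod_graft3 idI
    (s := Node (inl a) (Node (inr b) Lf Lf) Lf)
    (s' := Node (inr b) Lf (Node (inl a) Lf Lf))) => //.
  by split=> //; apply: RI; exact: dup_rel_lr.
- move=> a b t u v; apply: (congr_mod_graft3 idI
    (s := Node (inl a) (Node (inl b) Lf Lf) Lf)
    (s' := Node (inl (Order.min a b)) Lf (Node (inl a) Lf Lf))) => //.
  by split=> //; apply: RI; exact: dup_rel_ll.
- move=> a b t u v; apply: (congr_mod_graft3 idI
    (s := Node (inr (Order.min a b)) (Node (inr a) Lf Lf) Lf)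
    (s' := Node (inr a) Lf (Node (inr b) Lf Lf))) => //.
  by split=> //; apply: RI; exact: dup_rel_rr.
Qed.

Definition eval_lin n (x : Free K E n) : EvSpace K gamma n :=
  \sum_(t : ntree E n) (x t : K) *: bvec (nevtree gamma n) (eval t).

Fact eval_lin_is_linear n : linear (@eval_lin n).
Proof.
move=> a x y; rewrite /eval_lin scaler_sumr -big_split; apply: eq_bigr => c _ /=.
by rewrite !ffunE scalerDl scalerA.
Qed.
HB.instance Definition _ n := GRing.isLinear.Build K (Free K E n) (EvSpace K gamma n)
  *:%R (@eval_lin n) (@eval_lin_is_linear n).

Lemma eval_lin_fvec n t : leaves t = n ->
  eval_lin (fvec K n t) = bvec (nevtree gamma n) (eval t).
Proof.
move=> /eqP; exact: (sum_bvec (ntree E n) (fun t => bvec (nevtree gamma n) (eval t))).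
Qed.

(** Used to show that whatever depends on a tree only through its value vanishes on the kernel of
    [eval_lin]. *)
Lemma eval_lin_factor n (V : lmodType K) (g : evtree gamma -> V) (x : Free K E n) :
  \sum_(t : ntree E n) (x t : K) *: g (eval t) =
  \sum_(u : nevtree gamma n) (eval_lin x u : K) *: g u.
Proof.
under [RHS]eq_bigr => u _.
  rewrite sum_ffunE scaler_suml.
  under eq_bigr => t _ do rewrite ffunE -scalerA.
  over.
rewrite exchange_big /=; apply: eq_bigr => t _; rewrite -scaler_sumr.
by rewrite (sum_bvec (nevtree gamma n) g) // ev_nodes_eval (eqP (tree_ofP t)).
Qed.

(** The value of a graft depends on each factor only through the value of that factor, which may
    therefore be replaced by its normal form. *)
Lemma eval_ideal : operad_ideal (fun n => lker (linfun (@eval_lin n))).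
Proof.
have evpc m n i (x : Free K E m) (y : Free K E n) : eval_lin (Defs.pcomp i x y) =
    \sum_(s : ntree E m) \sum_(t : ntree E n)
      (x s * y t) *: bvec (nevtree gamma (m + n).-1) (eval (graft i s t)).
  rewrite /Defs.pcomp linear_sum; apply: eq_bigr => s _.
  rewrite linear_sum; apply: eq_bigr => t _; rewrite linearZ /= eval_lin_fvec //.
  by rewrite leaves_graft (eqP (tree_ofP s)) (eqP (tree_ofP t)).
split=> m n i x y _; rewrite !memv_ker !lfunE /= => /eqP ev0; rewrite evpc.
- rewrite exchange_big /= big1 // => t _.
  under eq_bigr => s _.
    rewrite mulrC -scalerA.
    rewrite (dcong_eval (dcong_graft i (tree_of t) (dcong_nf s))).
    over.
  rewrite -scaler_sumr (eval_lin_factor (fun e =>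
    bvec (nevtree gamma (m + n).-1) (eval (graft i (reify e) t)))) ev0.
  by rewrite big1 ?scaler0 // => u _; rewrite ffunE scale0r.
- rewrite big1 // => s _.
  under eq_bigr => t _.
    rewrite -scalerA.
    have -> : eval (graft i s t) = eval (graft i s (reify (eval t))).
      elim: (tree_of s) i => [[]|e l IHl r IHr] i /=; first by rewrite reifyK.
      by case: ifP => _ /=; rewrite (IHl, IHr).
    over.
  rewrite -scaler_sumr (eval_lin_factor (fun e =>
    bvec (nevtree gamma (m + n).-1) (eval (graft i s (reify e))))) ev0.
  by rewrite big1 ?scaler0 // => u _; rewrite ffunE scale0r.
Qed.

Lemma gen_ideal_eval n (x : Free K E n) :
  (x \in gen_ideal (dup_rel K gamma) (n := n)) = (eval_lin x == 0).
Proof.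
apply/idP/idP => [/asboolP/(_ _ eval_ideal)|/eqP ev0].
  rewrite memv_ker lfunE; apply; apply/span_subvP => y.
  rewrite !mem_cat => /or3P[] /allpairsP[[a b] [_ _ ->]] /=;
    rewrite memv_ker lfunE /= /hookl /hookr corolla2_1 corolla2_2 linearB /=;
    by rewrite !eval_lin_fvec // subr_eq0 eqxx.
apply/asboolP => I idI RI.
(* Since [eval_lin x = 0], the normal forms sum to zero and can be subtracted; each difference of a
   tree and its normal form lies in every ideal containing the relations. *)
have -> : x = \sum_(t : ntree E n) (x t : K) *:
    (fvec K n t - fvec K n (reify (eval t))).
  under eq_bigr do rewrite scalerBr; rewrite sumrB.
  rewrite (eval_lin_factor (fun e => fvec K n (reify e))) ev0.
  rewrite [X in _ - X]big1 => [|u _]; last by rewrite ffunE scale0r.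
  rewrite subr0; apply/ffunP => u; rewrite sum_ffunE (bigD1 u) //= big1 ?addr0.
    by rewrite !ffunE eqxx [RHS]mulr1.
  by move=> t tu; rewrite !ffunE val_eqE eq_sym (negPf tu) scaler0.
apply: memv_suml => t _; apply: memvZ.
have [_] := dcong_congr_mod idI RI (dcong_nf t).
by rewrite (eqP (tree_ofP t)).
Qed.

Definition dup_iso n (x : Dup K gamma n) : EvSpace K gamma n := eval_lin (repr x).

Lemma dup_isoE n (x : Free K E n) :
  dup_iso (quot_pi (gen_ideal_submod_closed (dup_rel K gamma) n) x) = eval_lin x.
Proof.
apply/eqP; rewrite -subr_eq0 -linearB -gen_ideal_eval.
by apply/(quot_eqP (gen_ideal_submod_closed _ _)); exact: reprK.
Qed.

Fact dup_iso_is_linear n : linear (@dup_iso n).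
Proof.
move=> a; elim/quotW=> x; elim/quotW=> y.
rewrite -[\pi_(Dup K gamma n) x]/(quot_pi (gen_ideal_submod_closed (dup_rel K gamma) n) x).
rewrite -[\pi_(Dup K gamma n) y]/(quot_pi (gen_ideal_submod_closed (dup_rel K gamma) n) y).
by rewrite -linearP !dup_isoE linearP.
Qed.
HB.instance Definition _ n := GRing.isLinear.Build K (Dup K gamma n) (EvSpace K gamma n)
  *:%R (@dup_iso n) (@dup_iso_is_linear n).

Lemma dup_iso_bij n : bijective (@dup_iso n).
Proof.
pose g (u : EvSpace K gamma n) : Free K E n :=
  \sum_(e : nevtree gamma n) (u e : K) *: fvec K n (reify e).
exists (fun u => quot_pi (gen_ideal_submod_closed (dup_rel K gamma) n) (g u)).
- elim/quotW=> x.
  rewrite -[\pi_(Dup K gamma n) x]/(quot_pi (gen_ideal_submod_closed (dup_rel K gamma) n) x).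
  rewrite dup_isoE; apply/quot_eqP; rewrite gen_ideal_eval.
  rewrite linearB /= subr_eq0; apply/eqP.
  rewrite /g -(eval_lin_factor (fun e => fvec K n (reify e))) linear_sum.
  by apply: eq_bigr => t _; rewrite linearZ /= eval_lin_fvec ?reifyK //
    leaves_reify ev_nodes_eval (eqP (tree_ofP t)).
- move=> u; rewrite dup_isoE /g linear_sum; apply/ffunP => e; rewrite sum_ffunE.
  rewrite (bigD1 e) //= big1 => [|e' ne]; rewrite linearZ /= eval_lin_fvec
    ?leaves_reify ?(eqP (evtree_ofP _)) // reifyK !ffunE.
    by rewrite eqxx addr0 [LHS]mulr1.
  by rewrite val_eqE eq_sym (negPf ne) scaler0.
Qed.

End DupIdeal.

(** * Words and the trees they index *)

Section Words.
Variable gamma : nat.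
Local Notation E := (dup_gen gamma).
Implicit Types (e f : E) (s b : seq E) (t : ftree E).

Definition isl e := if e is inl _ then true else false.
Definition lbl e : 'I_gamma := match e with inl a => a | inr a => a end.
Definition mins (a : 'I_gamma) s := foldr (fun e m => Order.min (lbl e) m) a s.

Lemma min_mins a c s : Order.min a (mins c s) = mins (Order.min a c) s.
Proof. by elim: s => //= e s <-; rewrite Order.TotalTheory.minCA. Qed.

Lemma mins_min a c s : Order.min (mins c s) a = mins (Order.min c a) s.
Proof. by elim: s => //= e s <-; rewrite Order.TotalTheory.minA. Qed.

Lemma mins_cat a s b : mins a (s ++ b) = mins (mins a b) s.
Proof. exact: foldr_cat. Qed.

Lemma minsC a s b : mins (mins a b) s = mins (mins a s) b.
Proof. by elim: s => //= e s ->; rewrite min_mins. Qed.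

(** Every letter after an l is an l: these are the words r ... r l ... l. *)
Definition good s := pairwise implb (map isl s).

Lemma good_cat s b : good (s ++ b) = [&& allrel implb (map isl s) (map isl b), good s & good b].
Proof. by rewrite /good map_cat pairwise_cat. Qed.

Lemma good_l s a b : good (s ++ inl a :: b) -> all isl b.
Proof. by rewrite good_cat /good /= all_map => /and3P[_ _ /andP[]]. Qed.

Lemma good_r s a b : good (s ++ inr a :: b) -> all (predC isl) s.
Proof.
rewrite good_cat /allrel all_map /= => /andP[/allP good_s _].
apply/allP => e /good_s /=; by case: e.
Qed.

(** The root letter is merged last. In a good word, the letters after an l are all l's and those
    before an r all r's, so by then it has absorbed the labels of that whole side. *)
Definition lab s1 f s2 : E :=
  match f with inl a => inl (mins a s2) | inr a => inr (mins a s1) end.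

(* The trees obtained from the word [s] by merging its letters one by one in some
   order: a letter [l_a] (resp. [r_a]) replaces its left (resp. right) neighbour
   [l_b] (resp. [r_b]) by [l_(min a b)] (resp. [r_(min a b)]) when it is merged. *)
Fixpoint fits t s : bool :=
  match t with
  | Leaf _ => s == [::]
  | Node e l r => if drop (nodes l) s is f :: s2 then
      [&& e == lab (take (nodes l) s) f s2, fits l (take (nodes l) s) & fits r s2]
      else false
  end.

Lemma fits_node e l r s1 f s2 : size s1 = nodes l ->
  fits (Node e l r) (s1 ++ f :: s2) = [&& e == lab s1 f s2, fits l s1 & fits r s2].
Proof. by move=> sz; rewrite /= -sz drop_size_cat // take_size_cat. Qed.

Lemma fits_size t s : fits t s -> size s = nodes t.
Proof.
elim: t s => [[]|e l IHl r IHr] s /=; first by move/eqP->.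
case Ds: drop => [|f s2] // /and3P[_ /IHl + /IHr <-].
rewrite -[in size s](cat_take_drop (nodes l) s) size_cat Ds /= => ->.
by rewrite addnS.
Qed.

Fixpoint adjL s b : seq E :=
  match s with
  | [::] => [::]
  | e :: s' => if s' is [::] then [:: if e is inl a then inl (mins a b) else e]
               else e :: adjL s' b
  end.

Definition adjR b s : seq E := if s is inr a :: s' then inr (mins a b) :: s' else s.

(** The word left once the block [b] has been merged: only an l just before it or an r just after it
    absorbs its labels. *)
Definition contract s1 b s2 := adjL s1 b ++ adjR b s2.

Lemma map_isl_adjL s b : map isl (adjL s b) = map isl s.
Proof. by elim: s => [|e [|f s] IH] //=; [case: e | congr cons; exact: IH]. Qed.

Lemma map_isl_adjR b s : map isl (adjR b s) = map isl s.
Proof. by case: s => [|[]]. Qed.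

Lemma size_contract s1 b s2 : size (contract s1 b s2) = (size s1 + size s2)%N.
Proof.
by rewrite size_cat -(size_map isl) map_isl_adjL -(size_map isl (adjR _ _))
  map_isl_adjR !size_map.
Qed.

Lemma good_contract s1 b s2 : good (s1 ++ b ++ s2) -> good (contract s1 b s2).
Proof.
rewrite /good /contract !map_cat map_isl_adjL map_isl_adjR.
rewrite !pairwise_cat allrel_catr.
by case/and3P=> /andP[_ ->] -> /and3P[_ _ ->].
Qed.

Lemma adjL_r s b : all (predC isl) s -> adjL s b = s.
Proof. by elim: s => [|e [|f s] IH] //= /andP[]; [case: e | move=> _ /IH eqs; congr cons; exact: eqs]. Qed.

Lemma adjR_l b s : all isl s -> adjR b s = s.
Proof. by case: s => [|[]]. Qed.

Lemma mins_adjL a e s b : all isl (e :: s) -> mins a (adjL (e :: s) b) = mins a (b ++ e :: s).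
Proof.
elim: s e => [|f s IH] e /=.
  by case: e => //= c _; rewrite mins_cat /= mins_min.
by case/andP=> _ /IH /= {}IH; rewrite -/(mins a (adjL (f :: s) b)) /= IH !mins_cat min_mins.
Qed.

Lemma mins_adjR a e s b : ~~ isl e -> mins a (adjR b (e :: s)) = mins a (b ++ e :: s).
Proof. by case: e => //= c _; rewrite mins_cat /= mins_min min_mins. Qed.

(** In a graft the block [b] of letters lying in [t2] is merged first, and [t1] then merges what
    remains. The condition being a product, every cut of a word sum is a tensor of two word sums. *)
Lemma fits_graft t1 t2 s1 b s2 : good (s1 ++ b ++ s2) ->
    size b = nodes t2 -> (size s1 + size s2)%N = nodes t1 ->
  fits (graft (size s1).+1 t1 t2) (s1 ++ b ++ s2) =
  fits t1 (contract s1 b s2) && fits t2 b.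
Proof.
elim: t1 s1 s2 => [[]|e l IHl r IHr] s1 s2 good_s szb sz /=.
  by case: s1 s2 sz {good_s} => [|? ?] [|? ?] //= _; rewrite cats0.
rewrite [leaves l]leaves_nodes ltnS; have [le_l|gt_l] := leqP (size s1) (nodes l).
  have [s21 [f [s22 [Ds2 sz21]]]] : exists s21 f s22,
      s2 = s21 ++ f :: s22 /\ (size s1 + size s21)%N = nodes l.
    move: sz => /= sz; exists (take (nodes l - size s1) s2).
    case Df: (drop (nodes l - size s1) s2) => [|f s22].
      by move/(congr1 size): Df; rewrite size_drop /=; lia.
    by exists f, s22; rewrite -Df cat_take_drop; split=> //; rewrite size_takel; lia.
  move: good_s sz; rewrite {}Ds2 /= size_cat /= => good_s sz.
  have -> : s1 ++ b ++ s21 ++ f :: s22 = (s1 ++ b ++ s21) ++ f :: s22 by rewrite -!catA.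
  rewrite -/(fits (Node e (graft (size s1).+1 l t2) r) _) fits_node; last first.
    by rewrite nodes_graft !size_cat szb -sz21; lia.
  rewrite IHl //; last first.
    by move: good_s; rewrite !catA good_cat => /and3P[].
  (* [f'] is the root letter as altered by the merge of [b], which can happen only if [s21] is
     empty. In all cases the minimum at the root is the same: the labels of [b] reach it directly or
     through [s21]. *)
  have [f' Dc Dl] : exists2 f', contract s1 b (s21 ++ f :: s22) =
      contract s1 b s21 ++ f' :: s22 &
      lab (contract s1 b s21) f' s22 = lab (s1 ++ b ++ s21) f s22.
    rewrite /contract; case: f good_s {sz} => a good_s.
      by exists (inl a) => //; case: s21 {good_s sz21} => [|[]? ?] /=; rewrite -?catA ?cats0.
    have /= all_r : all (predC isl) (s1 ++ b ++ s21).
      by apply: (@good_r _ a s22); rewrite -!catA.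
    move: all_r; rewrite !all_cat => /and3P[r1 rb].
    rewrite (adjL_r _ r1); case: s21 {good_s sz21} => [_|g s21 /=/andP[rg _]].
      by exists (inr (mins a b)); rewrite ?cats0 //= mins_cat.
    exists (inr a); first by case: g rg => //= c _; rewrite -catA.
    by rewrite /lab mins_cat mins_adjR // -mins_cat.
  rewrite Dc -/(fits (Node e l r) _) fits_node ?size_contract // Dl.
  by case: (e == _) => //=; case: (fits l _) => //=; rewrite andbC.
have [s11 [f [s12 [Ds1 sz11]]]] : exists s11 f s12,
    s1 = s11 ++ f :: s12 /\ size s11 = nodes l.
  exists (take (nodes l) s1).
  case Df: (drop (nodes l) s1) => [|f s12].
    by move/(congr1 size): Df; rewrite size_drop /=; lia.
  by exists f, s12; rewrite -Df cat_take_drop; split=> //; rewrite size_takel; lia.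
move: good_s sz gt_l; rewrite {}Ds1 !size_cat /= => good_s sz gt_l.
have -> : (s11 ++ f :: s12) ++ b ++ s2 = s11 ++ f :: (s12 ++ b ++ s2) by rewrite -!catA.
have -> : ((size s11 + (size s12).+1).+1 - (nodes l).+1)%N = (size s12).+1 by lia.
rewrite -/(fits (Node e l (graft (size s12).+1 r t2)) _) fits_node //.
rewrite IHr //; [|by move: good_s; rewrite -catA good_cat => /and3P[_ _ /andP[]]|lia].
have [f' Dc Dl] : exists2 f', contract (s11 ++ f :: s12) b s2 =
    s11 ++ f' :: contract s12 b s2 &
    lab s11 f' (contract s12 b s2) = lab s11 f (s12 ++ b ++ s2).
  have adj_cat s0 s : adjL (s0 ++ f :: s) b = s0 ++ adjL (f :: s) b.
    by elim: s0 => //= g s0 ->; case: s0.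
  rewrite /contract adj_cat -catA; case: f good_s {sz adj_cat} => a good_s.
    have /= all_l : all isl (s12 ++ b ++ s2).
      by apply: (@good_l s11 a); rewrite -!catA in good_s.
    move: all_l; rewrite !all_cat => /and3P[l12 lb l2].
    rewrite (adjR_l _ l2); case: s12 {good_s gt_l} l12 => [_|g s12 l12].
      by exists (inl (mins a b)); rewrite //= mins_cat minsC.
    exists (inl a) => //.
    by rewrite /lab !mins_cat mins_adjL // mins_cat minsC.
  by exists (inr a); rewrite //=; case: s12 {good_s gt_l}.
rewrite Dc -/(fits (Node e l r) _) fits_node // Dl.
by rewrite !andbA.
Qed.

Fixpoint inw t : seq E := if t is Node e l r then inw l ++ e :: inw r else [::].

Lemma size_inw t : size (inw t) = nodes t.
Proof. by elim: t => //= e l IHl r IHr; rewrite size_cat /= IHl IHr addnS. Qed.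

Definition rcomb s : ftree E := foldr (fun e t => Node e Lf t) Lf s.
(** The merging order in which no label changes: the r's from right to left, then the l's from left
    to right. The labels of the tree are those of the word. *)
Definition comb s : ftree E :=
  foldl (fun t e => Node e t Lf) (rcomb [seq e <- s | ~~ isl e]) [seq e <- s | isl e].

Lemma good_rcons s a : good s -> good (rcons s (inl a)).
Proof.
move=> good_s; rewrite -cats1 good_cat good_s andbT /allrel all_map.
by apply/allP => e _ /=; rewrite implybT.
Qed.

Lemma good_cons s a : good s -> good (inr a :: s).
Proof. by rewrite /good /= => ->; rewrite andbT; apply/allP. Qed.

Lemma comb_rcons s a : comb (rcons s (inl a)) = Node (inl a) (comb s) Lf.
Proof. by rewrite /comb !filter_rcons /= foldl_rcons. Qed.

Lemma comb_cons s a : all (predC isl) s -> comb (inr a :: s) = Node (inr a) Lf (comb s).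
Proof.
move=> all_r; rewrite /comb /= (eq_in_filter (a1 := isl) (a2 := pred0)) ?filter_pred0 //.
by move=> e /(allP all_r) /= /negPf.
Qed.

Lemma good_ind (P : seq E -> Prop) : P [::] ->
    (forall s a, good s -> P s -> P (rcons s (inl a))) ->
    (forall s a, all (predC isl) s -> P s -> P (inr a :: s)) ->
  forall s, good s -> P s.
Proof.
move=> P0 Pl Pr; apply: last_ind => [|s [a|a] IH] good_s //.
  have gs : good s by move: good_s; rewrite -cats1 good_cat => /and3P[].
  exact/Pl/IH.
move: good_s; rewrite -cats1 => /good_r rs {IH}.
have: all (predC isl) (s ++ [:: inr a]) by rewrite all_cat rs.
elim: (s ++ _) => //= -[] // c s' IH /= rs'; apply: Pr => //; exact: IH.
Qed.

(** Thus each word sum contains exactly one comb, and the combs serve as coordinates dual, up to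
    sign, to the words. *)
Lemma fits_comb s s' : good s' -> fits (comb s') s = (s == s').
Proof.
move=> good_s'; elim/good_ind: good_s' s => {s'} [|s' a _ IH|s' a rs' IH] s //.
  rewrite comb_rcons /=; case: (lastP s) => [|s1 f]; first by case: s' {IH}.
  have [sz|nsz] := eqVneq (size s1) (nodes (comb s')); last first.
    apply/idP/idP => [/(@fits_size (Node (inl a) (comb s') Lf))|/eqP/rcons_inj[Ds _]].
      by rewrite size_rcons /= addn0 => -[/eqP]; rewrite (negPf nsz).
    by case/eqP: nsz; apply: fits_size; rewrite IH Ds.
  rewrite -/(fits (Node (inl a) (comb s') Lf) _) -cats1 fits_node // IH /= andbT.
  rewrite cats1 eqseq_rcons andbC; congr andb.
  by case: f => c; rewrite /lab /= eq_sym.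
rewrite comb_cons //=; case: s => //= f s; rewrite IH // eqseq_cons; congr andb.
by case: f => c; rewrite /lab /= eq_sym.
Qed.

Lemma inw_comb s : good s -> inw (comb s) = s.
Proof.
elim/good_ind => // {}s a.
  by move=> _ IH; rewrite comb_rcons /= IH cats1.
by move=> rs IH; rewrite comb_cons //= IH.
Qed.

Lemma nodes_comb s : good s -> nodes (comb s) = size s.
Proof. by move=> good_s; rewrite -size_inw inw_comb. Qed.

Lemma leaves_comb s : good s -> leaves (comb s) = (size s).+1.
Proof. by move=> good_s; rewrite leaves_nodes nodes_comb. Qed.

Definition is_comb t := good (inw t) && (t == comb (inw t)).

Lemma is_combP t : reflect (exists2 s, good s & t = comb s) (is_comb t).
Proof.
apply: (iffP andP) => [[g /eqP ->]|[s g ->]]; last by rewrite inw_comb.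
by exists (inw t); rewrite ?inw_comb.
Qed.

(* Replacing the critical tree of a relation by the other trees decreases [wt]. *)
Fixpoint wt t : nat :=
  match t with
  | Leaf _ => 2
  | Node (inl _) l r => wt l + 2 * wt r
  | Node (inr _) l r => wt l * wt l * wt r
  end.

Lemma wt_gt1 t : (1 < wt t)%N.
Proof. by elim: t => //= -[] _ l IHl r IHr; nia. Qed.

(** The weight is strictly increasing in each subtree, so a local decrease passes to the whole
    tree. *)
Lemma wt_graft i (s t t' : ftree E) : (wt t < wt t')%N -> (wt (graft i s t) < wt (graft i s t'))%N.
Proof.
move=> lt_t; elim: s i => //= e l IHl r IHr i.
have := wt_gt1 l; have := wt_gt1 r => r1 l1.
case: ifP => _ /=; case: e => _.
- by rewrite ltn_add2r.
- by rewrite ltn_pmul2r ?ltn_mul //; lia.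
- by rewrite ltn_add2l ltn_pmul2l.
- by rewrite ltn_pmul2l // muln_gt0; lia.
Qed.

Definition fill3 t (A B D : ftree E) := graft 1 (graft 2 (graft 3 t D) B) A.

Definition lcor e f : ftree E := Node e (Node f Lf Lf) Lf.
Definition rcor e f : ftree E := Node e Lf (Node f Lf Lf).

(* The trees with two nodes that are not a left-hand side of the rules in the header. *)
Inductive crit : ftree E -> Prop :=
| crit_r a f : crit (rcor (inl a) f)
| crit_l a f : crit (lcor (inr a) f)
| crit_m a c : crit (rcor (inr a) (inl c)).

(** Without critical piece, an l has a leaf on its right, while an r has a leaf on its left and a
    leaf or an r on its right; such a tree is a comb. *)
Lemma crit_or_comb t : is_comb t \/
  exists i (s u A B D : ftree E), [/\ (1 <= i <= leaves s)%N, crit u & t = graft i s (fill3 u A B D)].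
Proof.
elim: t => [[]|e l [combl|[i [s [u [A [B [D [i_s cu ->]]]]]]]] r IHr]; first by left.
- case: IHr => [combr|[i [s [u [A [B [D [i_s cu ->]]]]]]]]; last first.
    right; exists (leaves l + i)%N, (Node e l s), u, A, B, D; split=> //.
      by case/andP: i_s => i1 i2; rewrite leavesN addn_gt0 i1 orbT leq_add2l.
    by rewrite /= ifN ?addKn // -ltnNge -addn1 leq_add2l; case/andP: i_s.
  case: e => a.
    case: r combr => [[]|f B D] _; last first.
      right; exists 1%N, Lf, (rcor (inl a) f), l, B, D; split=> //; exact: crit_r.
    left; apply/is_combP; have [s gs ->] := is_combP _ combl.
    by exists (rcons s (inl a)); rewrite ?good_rcons ?comb_rcons.
  case: l combl => [[]|f A B] _; last first.
    right; exists 1%N, Lf, (lcor (inr a) f), A, B, r; split=> //; exact: crit_l.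
  case: r combr => [[]|[c|c] B D] combr.
  + by left; apply/is_combP; exists [:: inr a].
  + right; exists 1%N, Lf, (rcor (inr a) (inl c)), Lf, B, D; split=> //; exact: crit_m.
  left; apply/is_combP; have [s gs Ds] := is_combP _ combr.
  (* A comb whose word contains an l has an l at its root, whereas [r] is rooted at an r. *)
  have rs : all (predC isl) s.
    move: Ds; rewrite /comb => Ds; apply/allP => g gs'; apply/negP => lg.
    have : g \in [seq x <- s | isl x] by rewrite mem_filter lg.
    case: (lastP [seq x <- s | isl x]) (Ds) (filter_all isl s) => // s' h.
    by rewrite foldl_rcons all_rcons => -[<-].
  by exists (inr a :: s); rewrite ?good_cons ?comb_cons ?Ds.
- right; exists i, (Node e s r), u, A, B, D; split=> //.
    by case/andP: i_s => -> i2; rewrite leavesN (leq_trans i2) ?leq_addr.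
  by rewrite /= ifT //; case/andP: i_s.
Qed.

(* The exponent for which the cut signs of the cofree cooperad depend on the
   position of the cut only, see [sg_graft]. *)
Fixpoint sg t : nat := if t is Node _ l r then (nodes l + (sg l + sg r))%N else 0.

Lemma sg_graft i t u : (1 <= i <= leaves t)%N ->
  (sg (graft i t u) + nodes u * nodes_after i t = sg t + sg u + nodes u * (leaves t - i))%N.
Proof.
elim: t i => [[]|e l IHl r IHr] i.
  by rewrite leavesLf /= => i1; rewrite (_ : 1 - i = 0)%N ?muln0 ?addn0 //; lia.
rewrite leavesN /= => i_t; case: leqP => i_l /=.
  have i1 : (1 <= i)%N by case/andP: i_t.
  have := IHl i; rewrite i1 i_l nodes_graft => /(_ isT) IH.
  rewrite (succ_nodes r) -addnBAC // -[in LHS]/(nodes_after i l + nodes r)%N.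
  rewrite !mulnDr mulnS; move: IH; set x := sg _; set y := (_ * nodes_after _ _)%N; set z := (_ * (_ - _))%N.
  by lia.
have := IHr (i - leaves l)%N; rewrite subn_gt0 i_l leq_subLR (andP i_t).2 => /(_ isT) IH.
rewrite (_ : (leaves l + leaves r - i)%N = (leaves r - (i - leaves l))%N); last first.
  by rewrite subnBA ?(ltnW i_l) // addnC.
by rewrite -!addnA IH; lia.
Qed.
End Words.

(** * The Koszul dual cooperad *)

Section Coef.
Variables (K : fieldType) (T : choiceType) (P : pred T) (sT : subFinType P).
Implicit Types x y : {ffun sT -> K^o}.

Lemma coefE x t (Pt : P t) : coef x t = x (Sub t Pt).
Proof. by rewrite /coef insubT. Qed.

Lemma coef_val x u : coef x (val u) = x u.
Proof. by rewrite /coef valK. Qed.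

Lemma coef_finfun (f : T -> K) t : P t ->
  coef ([ffun u : sT => f (val u) : K^o]) t = f t.
Proof. by move=> Pt; rewrite coefE ffunE SubK. Qed.

Definition coefl t x : K^o := coef x t.

Fact coefl_is_linear t : linear (coefl t).
Proof.
move=> a x y; rewrite /coefl /coef; case: insubP => [u _ _|_]; first by rewrite !ffunE.
by rewrite addr0 scaler0.
Qed.
HB.instance Definition _ t := GRing.isLinear.Build K {ffun sT -> K^o} K^o *:%R
  (coefl t) (coefl_is_linear t).

Lemma coef0 t : coef (0 : {ffun sT -> K^o}) t = 0.
Proof. exact: (linear0 (coefl t)). Qed.

Lemma coefB x y t : coef (x - y) t = coef x t - coef y t.
Proof. exact: (linearB (coefl t)). Qed.

Lemma coefD x y t : coef (x + y) t = coef x t + coef y t.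
Proof. exact: (linearD (coefl t)). Qed.

Lemma coefZ a x t : coef (a *: x) t = a * coef x t.
Proof. exact: (linearZ_LR (coefl t)). Qed.

Lemma coef_sum I (r : seq I) (F : I -> {ffun sT -> K^o}) t :
  coef (\sum_(i <- r) F i) t = \sum_(i <- r) coef (F i) t.
Proof. exact: (linear_sum (coefl t)). Qed.

End Coef.

Section Subcooperad.
Variables (K : fieldType) (E : finType).
Implicit Types C D : forall n, {vspace Free K E n}.

Lemma cut_topD p n i (x y : Free K E p) s :
  cut_top n i (x + y) s = cut_top n i x s + cut_top n i y s.
Proof. by apply/ffunP => t; rewrite !ffunE coefD mulrDr. Qed.

Lemma cut_botD p m i (x y : Free K E p) t :
  cut_bot m i (x + y) t = cut_bot m i x t + cut_bot m i y t.
Proof. by apply/ffunP => s; rewrite !ffunE coefD mulrDr. Qed.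

Lemma cut_topZ p n i a (x : Free K E p) s :
  cut_top n i (a *: x) s = a *: cut_top n i x s.
Proof. by apply/ffunP => t; rewrite !ffunE coefZ mulrCA. Qed.

Lemma cut_botZ p m i a (x : Free K E p) t :
  cut_bot m i (a *: x) t = a *: cut_bot m i x t.
Proof. by apply/ffunP => s; rewrite !ffunE coefZ mulrCA. Qed.

Lemma subcooperadD C D : subcooperad C -> subcooperad D ->
  subcooperad (fun n => (C n + D n)%VS).
Proof.
move=> subC subD; split=> m n i x u i_m /memv_addP[y Cy [z Dz ->]].
- rewrite cut_topD; apply: memv_add; first exact: (subcooperad_top subC).
  exact: (subcooperad_top subD).
- rewrite cut_botD; apply: memv_add; first exact: (subcooperad_bot subC).
  exact: (subcooperad_bot subD).
Qed.

(** The two elements come with possibly different subcooperads; their sum is a subcooperad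
    containing both. *)
Lemma koszul_dualB R n (x y : Free K E n) :
  koszul_dual R x -> koszul_dual R y -> koszul_dual R (x - y).
Proof.
move=> [C [subC C3 Cx]] [D [subD D3 Dy]]; exists (fun n => (C n + D n)%VS).
split; [exact: subcooperadD | by rewrite subv_add C3|].
by rewrite memv_add ?memvN.
Qed.

End Subcooperad.

Section Dual.
Variables (K : fieldType) (gamma : nat).
Local Notation E := (dup_gen gamma).
Implicit Types (e f : E) (s b : seq E) (t u : ftree E).

Definition wvect n s : Free K E n :=
  [ffun t : ntree E n => (-1) ^+ sg t * (fits t s)%:R : K^o].

Lemma coef_wvect n s t : leaves t = n ->
  coef (wvect n s) t = (-1) ^+ sg t * (fits t s)%:R.
Proof.
move=> /eqP; exact: (@coef_finfun K _ _ (ntree E n) (fun t => (-1) ^+ sg t * (fits t s)%:R)).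
Qed.

(** The matrix of a cut has rank one: up to a sign fixed by position and sizes, it is the product of
    the coefficients of the contracted word at [t] and of the block at [u]. *)
Lemma coef_wvect_graft m n i s t u : good s -> size s = (m + n.+1).-1.-1 ->
    (1 <= i <= m)%N -> leaves t = m -> leaves u = n.+1 ->
  cut_sign K i t u * coef (wvect (m + n.+1).-1 s) (graft i t u) =
    (-1) ^+ (n * (m - i)) *
      ((-1) ^+ sg t * (fits t (contract (take i.-1 s) (take n (drop i.-1 s))
                                        (drop (i.-1 + n) s)))%:R) *
      ((-1) ^+ sg u * (fits u (take n (drop i.-1 s)))%:R).
Proof.
move=> good_s szs i_m tm un; rewrite coef_wvect ?leaves_graft ?tm ?un //.
rewrite /cut_sign [LHS]mulrA -exprD addnC sg_graft ?tm //.
have nu : nodes u = n by apply: succn_inj; rewrite -succ_nodes.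
have nt : (nodes t).+1 = m by rewrite -succ_nodes.
have [i1 im] := andP i_m; rewrite nu.
set s1 := take i.-1 s; set b := take n (drop i.-1 s); set s2 := drop (i.-1 + n) s.
have Ds : s1 ++ b ++ s2 = s.
  by rewrite /s2 addnC -drop_drop cat_take_drop cat_take_drop.
have sz1 : size s1 = i.-1 by rewrite size_takel // szs; lia.
have -> : fits (graft i t u) s = fits t (contract s1 b s2) && fits u b.
  rewrite -[in LHS]Ds -[in LHS](prednK i1) -sz1 fits_graft // ?Ds //.
    by rewrite size_takel ?nu // size_drop szs; lia.
  by rewrite sz1 /s2 size_drop szs; lia.
by rewrite -mulnb natrM exprD exprD; ring.
Qed.

Definition good_words k : seq (seq E) :=
  [seq s <- [seq tval w | w <- enum {: k.-tuple E}] | good s].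

Lemma mem_good_words k s : (s \in good_words k) = good s && (size s == k).
Proof.
rewrite mem_filter; congr andb; apply/mapP/idP => [[w _ ->]|szs].
  by rewrite size_tuple.
by exists (Tuple szs); rewrite ?mem_enum.
Qed.

Lemma uniq_good_words k : uniq (good_words k).
Proof. by rewrite filter_uniq // map_inj_uniq ?enum_uniq //; exact: val_inj. Qed.

Definition wspace n : {vspace Free K E n} := <<map (wvect n) (good_words n.-1)>>%VS.

Lemma wvect_wspace n s : good s -> size s = n.-1 -> wvect n s \in wspace n.
Proof.
by move=> good_s /eqP szs; apply/memv_span/map_f; rewrite mem_good_words good_s.
Qed.

Lemma wspace_ind n (P : Free K E n -> Prop) :
    (forall a x y, P x -> P y -> P (a *: x + y)) -> P 0 ->
    (forall s, good s -> size s = n.-1 -> P (wvect n s)) ->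
  forall x, x \in wspace n -> P x.
Proof.
move=> Plin P0 Pw x; rewrite /wspace; set X := map _ _ => Xx.
have {Pw}: forall y, y \in X -> P y.
  by move=> y /mapP[s]; rewrite mem_good_words => /andP[gs /eqP szs] ->; apply: Pw.
have /coord_span-> : x \in <<in_tuple X>>%VS by [].
move=> PX; elim/big_ind: _ => //.
- by move=> y z Py Pz; rewrite -[y]scale1r; apply: Plin.
- by move=> i _; rewrite -[_ *: _]addr0; apply: Plin => //; apply: PX; rewrite mem_nth.
Qed.

Lemma free0_eq0 (x : Free K E 0) : x = 0.
Proof. by apply/ffunP => -[t t0]; have := leaves_gt0 t; rewrite (eqP t0). Qed.

Lemma wspace_subcooperad : subcooperad wspace.
Proof.
(* Arity 0 is set apart because it contains no tree, whereas a block has [n] letters in arity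
   [n.+1]. *)
split=> m [|n] i x u i_m.
- by move=> _; rewrite (free0_eq0 (cut_top _ _ _ _)) mem0v.
- move: x; apply: wspace_ind => [a x y Cx Cy||s good_s szs].
  + by rewrite cut_topD cut_topZ memvD ?memvZ.
  + rewrite (_ : cut_top _ _ _ _ = 0) ?mem0v //; apply/ffunP => t.
    by rewrite !ffunE coef0 mulr0.
  have -> : cut_top n.+1 i (wvect (m + n.+1).-1 s) u = (-1) ^+ (n * (m - i)) *
      ((-1) ^+ sg u * (fits u (contract (take i.-1 s) (take n (drop i.-1 s))
         (drop (i.-1 + n) s)))%:R) *: wvect n.+1 (take n (drop i.-1 s)).
    apply/ffunP => t; rewrite [LHS]ffunE coef_wvect_graft ?(eqP (tree_ofP _)) //.
    by rewrite !ffunE.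
  apply/memvZ/wvect_wspace; last first.
    by rewrite size_takel // size_drop szs; lia.
  move: good_s; rewrite -{1}(cat_take_drop i.-1 s) good_cat => /and3P[_ _].
  by rewrite -{1}(cat_take_drop n (drop _ _)) good_cat => /and3P[].
- by case: u => t t0; have := leaves_gt0 t; rewrite (eqP t0).
- move: x; apply: wspace_ind => [a x y Cx Cy||s good_s szs].
  + by rewrite cut_botD cut_botZ memvD ?memvZ.
  + rewrite (_ : cut_bot _ _ _ _ = 0) ?mem0v //; apply/ffunP => t.
    by rewrite !ffunE coef0 mulr0.
  set c := contract (take i.-1 s) (take n (drop i.-1 s)) (drop (i.-1 + n) s).
  have -> : cut_bot m i (wvect (m + n.+1).-1 s) u = (-1) ^+ (n * (m - i)) *
      ((-1) ^+ sg u * (fits u (take n (drop i.-1 s)))%:R) *: wvect m c.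
    apply/ffunP => t; rewrite [LHS]ffunE coef_wvect_graft ?(eqP (tree_ofP _)) //.
    by rewrite !ffunE -/c [RHS]mulrAC.
  apply/memvZ/wvect_wspace; last first.
    by rewrite size_contract size_takel ?size_drop szs; lia.
  apply: good_contract.
  by rewrite addnC -drop_drop cat_take_drop cat_take_drop.
Qed.

Lemma ntree3_cases t : leaves t = 3 ->
  (exists e f, t = lcor e f) \/ (exists e f, t = rcor e f).
Proof.
case: t => [[]|e [[]|f l l'] [[]|g r r']] //; rewrite !leavesN ?leavesLf.
- have := leaves_gt0 r; have := leaves_gt0 r'.
  case: r => [[]|? ? ?]; case: r' => [[]|? ? ?] //; rewrite ?leavesN ?leavesLf.
  + by right; exists e, g.
  + by rewrite !(succ_nodes); lia.
  + by rewrite !(succ_nodes); lia.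
  + by rewrite !(succ_nodes); lia.
- case: l => [[]|? ? ?]; case: l' => [[]|? ? ?] //; rewrite ?leavesN ?leavesLf.
  + by left; exists e, f.
  + by rewrite !(succ_nodes); lia.
  + by rewrite !(succ_nodes); lia.
  + by rewrite !(succ_nodes); lia.
- by rewrite !(succ_nodes); lia.
Qed.

Lemma node_eqE e l r e' l' r' :
  ((Node e l r : ftree E) == Node e' l' r') = [&& e == e', l == l' & r == r'].
Proof.
apply/eqP/and3P => [[-> -> ->]|[/eqP-> /eqP-> /eqP->]] //; by split.
Qed.

(** A word of length two fits exactly the two trees of one relation. The exponent [sg] is 1 on
    [lcor] and 0 on [rcor], whence the opposite signs and the overall factor -1. *)
Lemma wspace3 : (wspace 3 <= dup_rel K gamma)%VS.
Proof.
apply/subvP; apply: wspace_ind => [a x y Rx Ry||s good_s szs].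
- by rewrite memvD ?memvZ.
- exact: mem0v.
case: s szs good_s => [|x [|y []]] // _ good_xy.
suff [c [u [v [Ruv ->]]]] : exists c u v, fvec K 3 u - fvec K 3 v \in dup_rel K gamma /\
    wvect 3 [:: x; y] = c *: (fvec K 3 u - fvec K 3 v) by apply: memvZ.
have val3 c u v : (forall e f, (-1) ^+ sg (lcor e f) * (fits (lcor e f) [:: x; y])%:R =
      c * ((lcor e f == u)%:R - (lcor e f == v)%:R) :> K) ->
    (forall e f, (-1) ^+ sg (rcor e f) * (fits (rcor e f) [:: x; y])%:R =
      c * ((rcor e f == u)%:R - (rcor e f == v)%:R) :> K) ->
    wvect 3 [:: x; y] = c *: (fvec K 3 u - fvec K 3 v).
  move=> Hl Hr; apply/ffunP => -[t t3]; rewrite !ffunE.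
  by case: (ntree3_cases (eqP t3)) => [][e [f Dt]] /=; rewrite {t3}Dt; [apply: Hl|apply: Hr].
have andb0 (b : bool) : b && false = false by rewrite andbF.
case: x y good_xy val3 => x [] y // _ val3; exists (-1).
- exists (lcor (inl y) (inl x)), (rcor (inl (Order.min y x)) (inl y)).
  split; [exact: dup_rel_ll | apply: val3 => e f]; rewrite !node_eqE /=
    !eqxx !andbT ?andb0 ?subr0 ?sub0r ?expr0 ?expr1 ?mulrNN //.
- exists (lcor (inl y) (inr x)), (rcor (inr x) (inl y)).
  split; [exact: dup_rel_lr | apply: val3 => e f]; rewrite !node_eqE /=
    !eqxx !andbT ?andb0 ?subr0 ?sub0r ?expr0 ?expr1 ?mulrNN //.
- exists (lcor (inr (Order.min x y)) (inr x)), (rcor (inr x) (inr y)).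
  split; [exact: dup_rel_rr | apply: val3 => e f]; rewrite !node_eqE /=
    !eqxx !andbT ?andb0 ?subr0 ?sub0r ?expr0 ?expr1 ?mulrNN //.
Qed.

Lemma wvect_koszul_dual n s : good s -> size s = n.-1 ->
  koszul_dual (dup_rel K gamma) (wvect n s).
Proof.
move=> good_s szs; exists wspace; split; [exact: wspace_subcooperad | exact: wspace3|].
exact: wvect_wspace.
Qed.

Lemma sign_graft i t u : (1 <= i <= leaves t)%N ->
  (-1) ^+ sg (graft i t u) =
  (-1) ^+ (sg t + nodes u * (leaves t - i)) * ((-1) ^+ sg u * cut_sign K i t u).
Proof.
move=> /(sg_graft u) Dg; rewrite mulrA -exprD addnAC -Dg exprD -mulrA.
by rewrite /cut_sign -expr2 sqrr_sign mulr1.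
Qed.

(** With this sign, a cut multiplies the coefficients by a constant independent of the piece that
    varies. *)
Definition scoef n (x : Free K E n) t : K := (-1) ^+ sg t * coef x t.

Lemma scoef_cut_top C p m n i (x : Free K E p) t : subcooperad C -> x \in C p ->
    p = (m + n).-1 -> leaves t = m -> (1 <= i <= m)%N ->
  exists c, exists2 y : Free K E n, y \in C n &
    forall u, leaves u = n -> scoef x (graft i t u) = c * scoef y u.
Proof.
move=> subC Cx Dp tm i_m; rewrite Dp in x Cx *; move: (tm) => /eqP tm'.
exists ((-1) ^+ (sg t + n.-1 * (m - i))), (cut_top n i x t).
  exact: (subcooperad_top subC (NTree tm')).
move=> u un; rewrite /scoef /cut_top.
rewrite (@coef_finfun K _ _ (ntree E n) (fun u => cut_sign K i t u * coef x (graft i t u)));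
  last by rewrite un.
have -> : n.-1 = nodes u by rewrite -un succ_nodes.
by rewrite sign_graft ?tm // -!mulrA.
Qed.

Lemma scoef_cut_bot C p m n i (x : Free K E p) u : subcooperad C -> x \in C p ->
    p = (m + n).-1 -> leaves u = n -> (1 <= i <= m)%N ->
  exists c, exists2 y : Free K E m, y \in C m &
    forall t, leaves t = m -> scoef x (graft i t u) = c * scoef y t.
Proof.
move=> subC Cx Dp un i_m; rewrite Dp in x Cx *; move: (un) => /eqP un'.
exists ((-1) ^+ (sg u + n.-1 * (m - i))), (cut_bot m i x u).
  exact: (subcooperad_bot subC (NTree un')).
move=> t tm; rewrite /scoef /cut_bot.
rewrite (@coef_finfun K _ _ (ntree E m) (fun t => cut_sign K i t u * coef x (graft i t u)));
  last by rewrite tm.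
have -> : n.-1 = nodes u by rewrite -un succ_nodes.
by rewrite sign_graft ?tm // !exprD; ring.
Qed.

(** Everything around the two-node piece is cut off, which leaves an element of [C 3]: linear
    conditions satisfied by the relations hold for the coefficients in every context. *)
Lemma scoef_fill3 C p i (x : Free K E p) t A B D : subcooperad C -> x \in C p ->
    p = (leaves t + (leaves A + (leaves B + leaves D))).-1 -> (1 <= i <= leaves t)%N ->
  exists c, exists2 y : Free K E 3, y \in C 3 &
    forall u, leaves u = 3 -> scoef x (graft i t (fill3 u A B D)) = c * scoef y u.
Proof.
move=> subC Cx Dp i_t.
have [A0 B0 D0] := And3 (leaves_gt0 A) (leaves_gt0 B) (leaves_gt0 D).
have [c1 [y1 Cy1 Dy1]] := scoef_cut_top subC Cx Dp erefl i_t.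
have [||c2 [y2 Cy2 Dy2]] := @scoef_cut_bot C _ (1 + (leaves B + leaves D)).-1.+1 _ 1 y1 A
  subC Cy1 _ erefl; rewrite //=; try lia.
have [||c3 [y3 Cy3 Dy3]] := @scoef_cut_bot C _ (2 + leaves D)%N _ 2 y2 B
  subC Cy2 _ erefl; rewrite //=; try lia.
have [||c4 [y4 Cy4 Dy4]] := @scoef_cut_bot C _ 3 _ 3 y3 D subC Cy3 _ erefl; rewrite //=; try lia.
exists (c1 * (c2 * (c3 * c4))); exists y4 => // u u3.
have l1 : leaves (graft 3 u D) = (2 + leaves D)%N by rewrite leaves_graft u3.
have l2 : leaves (graft 2 (graft 3 u D) B) = (1 + (leaves B + leaves D)).-1.+1.
  by rewrite leaves_graft l1; lia.
have l3 : leaves (fill3 u A B D) = (leaves A + (leaves B + leaves D))%N.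
  by rewrite leaves_graft l2; lia.
by rewrite Dy1 // Dy2 // Dy3 // Dy4 // !mulrA.
Qed.

Lemma dup_rel_ind (f : {linear Free K E 3 -> K^o}) :
    (forall a c, f (fvec K 3 (lcor (inl a) (inr c)) - fvec K 3 (rcor (inr c) (inl a))) = 0) ->
    (forall a c, f (fvec K 3 (lcor (inl a) (inl c))
                    - fvec K 3 (rcor (inl (Order.min a c)) (inl a))) = 0) ->
    (forall a c, f (fvec K 3 (lcor (inr (Order.min a c)) (inr a))
                    - fvec K 3 (rcor (inr a) (inr c))) = 0) ->
  forall x, x \in dup_rel K gamma -> f x = 0.
Proof.
move=> flr fll frr x Rx; suff: x \in lker (linfun f) by rewrite memv_ker lfunE => /eqP.
apply: (subvP _ _ Rx); apply/span_subvP => y.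
rewrite !mem_cat => /or3P[] /allpairsP[[a b] [_ _ ->]] /=;
  rewrite memv_ker lfunE /= /hookl /hookr corolla2_1 corolla2_2; apply/eqP.
- exact: flr.
- exact: fll.
- exact: frr.
Qed.

(* The two trees of a relation have the same image, and a critical tree is its
   own image. *)
Definition lead t : ftree E :=
  match t with
  | Node (inl a) (Node (inl b) _ _) _ => rcor (inl (Order.min a b)) (inl a)
  | Node (inl a) (Node (inr b) _ _) _ => rcor (inr b) (inl a)
  | Node (inr a) (Leaf _) (Node (inr b) _ _) => lcor (inr (Order.min a b)) (inr a)
  | _ => t
  end.

Lemma lead_crit t : crit t -> lead t = t.
Proof. by case=> [a [c|c]|a [c|c]|a c]. Qed.

(** This is what the constants of [wt] are for: the factor 2 makes the relation between two l's
    strict, the square the one between two r's, and the mixed one uses [1 < wt A * wt A]. *)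
Lemma wt_lead t A B D : leaves t = 3 -> t != lead t ->
  (wt (fill3 t A B D) < wt (fill3 (lead t) A B D))%N.
Proof.
have [A1 B1 D1] := And3 (wt_gt1 A) (wt_gt1 B) (wt_gt1 D).
have rot_r : (wt A * wt A * wt B + 2 * wt D < wt A * wt A * (wt B + 2 * wt D))%N.
  by rewrite mulnDr ltn_add2l ltn_Pmull //; nia.
have rot_rr : (wt A * wt A * (wt B * wt B * wt D) <
    wt A * wt A * wt B * (wt A * wt A * wt B) * wt D)%N.
  apply: (@leq_trans (wt A * wt A * (wt A * wt A * (wt B * wt B * wt D)))); last by lia.
  by rewrite ltn_Pmull ?muln_gt0; lia.
by case/ntree3_cases => -[[a|a] [[c|c] ->]] /=; rewrite ?eqxx // => _; lia.
Qed.

(** The sum of the coordinates over a fibre of [lead]. A fibre may hold many trees, since a minimum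
    forgets the larger label. *)
Definition lead_sum w (x : Free K E 3) : K^o :=
  \sum_(t : ntree E 3) (x t : K) *: ((lead t == w)%:R : K^o).

Fact lead_sum_is_linear w : linear (lead_sum w).
Proof.
move=> a x y; rewrite /lead_sum scaler_sumr -big_split; apply: eq_bigr => t _ /=.
by rewrite !ffunE scalerDl scalerA.
Qed.
HB.instance Definition _ w := GRing.isLinear.Build K (Free K E 3) K^o *:%R
  (lead_sum w) (lead_sum_is_linear w).

Lemma lead_sum_fvec w t : leaves t = 3 -> lead_sum w (fvec K 3 t) = (lead t == w)%:R.
Proof. move/eqP; exact: (sum_bvec (ntree E 3) (fun t => (lead t == w)%:R : K^o)). Qed.

Lemma lead_sum0 w x : x \in dup_rel K gamma -> lead_sum w x = 0.
Proof.
by apply: dup_rel_ind => a c; rewrite linearB /= !lead_sum_fvec // subrr.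
Qed.

(** In the sum over the fibre of [u], which is zero, all trees but [u] are lighter than [u] in every
    context. *)
Lemma scoef_dup_rel (x : Free K E 3) u : x \in dup_rel K gamma -> crit u ->
    (forall v, leaves v = 3 ->
      (forall A B D, wt (fill3 v A B D) < wt (fill3 u A B D))%N -> scoef x v = 0) ->
  scoef x u = 0.
Proof.
move=> Rx cu small0; rewrite /scoef.
have u3 : leaves u == 3%N by case: cu => [a [c|c]|a [c|c]|a c].
have := lead_sum0 u Rx; rewrite /lead_sum (bigD1 (NTree u3)) //= big1 ?addr0.
  by rewrite lead_crit // eqxx -(coef_val x) => /eqP; rewrite [_ *: _]mulr1 => /eqP->;
    rewrite mulr0.
move=> t tu; case: (lead t =P u) => [ltu|_]; last by rewrite scaler0.
suff /eqP : scoef x t = 0.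
  by rewrite /scoef coef_val mulf_eq0 signr_eq0 => /eqP ->; rewrite scale0r.
apply: small0 => [|A B D]; first exact/eqP/tree_ofP.
rewrite -ltu wt_lead //; first exact/eqP/tree_ofP.
by rewrite ltu.
Qed.

(** Strong induction on the weight of the tree: combs are covered by assumption, and a critical
    piece reduces any other tree to lighter ones. Nothing is used of [C] beyond its being a
    subcooperad with [C 3] inside the relations. *)
Lemma koszul_dual_eq0 n (x : Free K E n) : koszul_dual (dup_rel K gamma) x ->
  (forall s, good s -> size s = n.-1 -> coef x (comb s) = 0) -> x = 0.
Proof.
case=> C [subC /subvP C3 Cx] comb0; apply/ffunP => v; rewrite [RHS]ffunE -(coef_val x v).
suff scoef0 k t : (wt t < k)%N -> leaves t = n -> scoef x t = 0.
  apply/eqP; have /eqP := scoef0 _ v (leqnn _) (eqP (tree_ofP v)).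
  by rewrite /scoef mulf_eq0 signr_eq0.
elim: k t => // k IH t lt_t tn.
have [/is_combP[s good_s Dt]|[i [s [u [A [B [D [i_s cu Dt]]]]]]]] := crit_or_comb t.
  rewrite /scoef Dt comb0 ?mulr0 //.
  by apply: succn_inj; rewrite -leaves_comb // -Dt -tn prednK // leaves_gt0.
have ln v' : leaves v' = 3 -> leaves (graft i s (fill3 v' A B D)) =
    (leaves s + (leaves A + (leaves B + leaves D))).-1.
  move=> v3; rewrite /fill3 !leaves_graft v3.
  by have := leaves_gt0 D; have := leaves_gt0 B; lia.
have u3 : leaves u = 3 by case: cu => [a [c|c]|a [c|c]|a c].
have Dn : n = (leaves s + (leaves A + (leaves B + leaves D))).-1.
  by rewrite -tn Dt ln.
have [c [y Cy Dy]] := scoef_fill3 subC Cx Dn i_s.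
rewrite Dt Dy //; have [->|c0] := eqVneq c 0; first by rewrite mul0r.
rewrite (scoef_dup_rel (C3 _ Cy) cu) ?mulr0 // => v' v3 lt_v.
apply: (mulfI c0); rewrite mulr0 -Dy //; apply: IH; last by rewrite ln.
apply: (@leq_trans (wt t)); [by rewrite Dt wt_graft | exact: lt_t].
Qed.

(** The difference of the two sides lies in the dual and vanishes on all combs. *)
Lemma koszul_dual_expand n (x : Free K E n) : koszul_dual (dup_rel K gamma) x ->
  x = \sum_(s <- good_words n.-1) scoef x (comb s) *: wvect n s.
Proof.
move=> dual_x; apply/eqP; rewrite -subr_eq0; apply/eqP/koszul_dual_eq0.
  apply: koszul_dualB => //; exists wspace; split.
  - exact: wspace_subcooperad.
  - exact: wspace3.
  rewrite big_seq; apply: memv_suml => s; rewrite mem_good_words => /andP[gs /eqP szs].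
  by apply/memvZ/wvect_wspace.
move=> s good_s szs; rewrite coefB coef_sum.
case: n x dual_x szs => [|n] x dual_x szs.
  by rewrite (free0_eq0 x) coef0 big1 ?subrr // => s' _; rewrite (free0_eq0 (_ *: _)) coef0.
have ln : leaves (comb s) = n.+1 by rewrite leaves_comb // szs.
rewrite (bigD1_seq s) ?uniq_good_words ?mem_good_words ?good_s ?szs //=.
rewrite coefZ coef_wvect // fits_comb // eqxx mulr1 big1 => [|s' s's].
  by rewrite addr0 /scoef mulrAC -expr2 sqrr_sign mul1r subrr.
by rewrite coefZ coef_wvect // fits_comb // (negPf s's) !mulr0.
Qed.

End Dual.

(** * Merging and splitting words *)

Section Homotopy.
Variable gamma : nat.
Local Notation E := (dup_gen gamma).
Local Notation word := (evtree gamma * seq (E * evtree gamma))%type.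
(* [(x, [:: (s_1, x_1); ...; (s_k, x_k)])] stands for [x s_1 x_1 ... s_k x_k]. *)
Implicit Types (x y : evtree gamma) (w : seq (E * evtree gamma)) (v : word).

Definition letters v : seq E := unzip1 v.2.
Definition vals v : seq (evtree gamma) := v.1 :: unzip2 v.2.
Definition wsum v : nat := sumn (map (@ev_nodes gamma) (vals v)).

Definition adjRw e w : seq (E * evtree gamma) :=
  if w is (inr a, z) :: w' then (inr (mins a [:: e]), z) :: w' else w.

Fixpoint merge_rec i x w : word :=
  match w, i with
  | [::], _ => (x, [::])
  | (e, y) :: w', 0 => (act e x y, adjRw e w')
  | (e, y) :: w', i'.+1 => let v := merge_rec i' y w' in
     (x, ((if (i', e, w') is (0, inl a, (f, _) :: _) then inl (mins a [:: f]) else e),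
          v.1) :: v.2)
  end.

Definition merge_word i v := merge_rec i v.1 v.2.

(* Splits the value that follows the last [r]; the first component is its
   position, at which merging the result gives the word back. *)
Fixpoint rsplit x w : option (nat * word) :=
  if w is (inr b, y) :: w' then
    if rsplit y w' is Some (j, v) then Some (j.+1, (x, (inr b, v.1) :: v.2)) else None
  else let: EVNode L R := x in
    if L is Some (c, u) then Some (0%N, (u, (inr c, EVNode None R) :: w)) else None.

Definition lsplit x w : option (nat * word) :=
  if w is (inr _, _) :: _ then None
  else if x is EVNode None (Some (c, u)) then Some (0%N, (ev1 gamma, (inl c, u) :: w))
  else None.

Definition split_word v : option (nat * word) :=
  if rsplit v.1 v.2 is Some r then Some r else lsplit v.1 v.2.

Lemma letters_adjRw e w : unzip1 (adjRw e w) = adjR [:: e] (unzip1 w).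
Proof. by case: w => [|[[] ?]]. Qed.

Lemma vals_adjRw e w : unzip2 (adjRw e w) = unzip2 w.
Proof. by case: w => [|[[] ?]]. Qed.

Lemma letters_merge i v : (i < size v.2)%N ->
  letters (merge_word i v) = contract (take i (letters v)) (take 1 (drop i (letters v)))
                                 (drop i.+1 (letters v)).
Proof.
case: v => x w; rewrite /merge_word /letters /=.
elim: i x w => [|i IH] x [|[e y] w] //=.
  by rewrite take0 drop0 letters_adjRw.
rewrite ltnS => /IH /= ->; rewrite /contract.
by case: i {IH} w => [|i] [|[f z] w] //=; rewrite ?take0; case: e.
Qed.

Lemma size_merge_word i v : (i < size v.2)%N -> size (merge_word i v).2 = (size v.2).-1.
Proof.
move=> iv; rewrite -(size_map fst) -/(unzip1 _) -/(letters _) letters_merge //.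
by rewrite size_contract size_take size_drop size_map iv; lia.
Qed.

Lemma good_merge i v : (i < size v.2)%N -> good (letters v) -> good (letters (merge_word i v)).
Proof.
move=> iv; rewrite letters_merge // => gv; apply: good_contract.
by rewrite -[i.+1]add1n -drop_drop !cat_take_drop.
Qed.

Fixpoint mrg (A : Type) (op : A -> A -> A) i (s : seq A) : seq A :=
  match s with
  | x :: (y :: s') as s'' => if i is i'.+1 then x :: mrg op i' s'' else op x y :: s'
  | _ => s
  end.

Lemma vals_merge i v e : (i < size v.2)%N ->
  vals (merge_word i v) = mrg (act (nth e (letters v) i)) i (vals v).
Proof.
case: v => x w; rewrite /merge_word /letters /vals /=.
elim: i x w => [|i IH] x [|[f y] w] //=.
  by rewrite vals_adjRw.
rewrite ltnS => lt_i; have /= := IH y w lt_i.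
by case: w {IH} lt_i => [|[g z] w] //= _ ->.
Qed.

Lemma wsum_merge i v : (i < size v.2)%N -> wsum (merge_word i v) = wsum v.
Proof.
case: v => x w; rewrite /wsum /vals /merge_word /=.
elim: i x w => [|i IH] x [|[f y] w] //=.
  by rewrite ev_nodes_act addnA vals_adjRw.
by rewrite ltnS => /IH /= ->.
Qed.

Definition rcons_word x b v : word := (x, (inr b, v.1) :: v.2).

Lemma rsplit_r x b y w : rsplit x ((inr b, y) :: w) =
  omap (fun r => (r.1.+1, rcons_word x b r.2)) (rsplit y w).
Proof. by rewrite /=; case: rsplit => [[]|]. Qed.

Lemma merge_r i x b v : merge_word i.+1 (rcons_word x b v) = rcons_word x b (merge_word i v).
Proof. by case: i v => [|i] [y [|[f z] w]]. Qed.

(** Testing the first letter is enough, since the r's of a good word come first. *)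
Definition no_r w := if w is (inr _, _) :: _ then false else true.

Lemma good_no_r a y w : good (unzip1 ((inl a, y) :: w)) -> no_r w.
Proof. by move/(@good_l _ [::]); case: w => [|[[]]]. Qed.

Lemma rsplit_no_r c u R w : no_r w -> rsplit (EVNode (Some (c, u)) R) w =
  Some (0%N, (u, (inr c, EVNode None R) :: w)).
Proof. by case: w => [|[[]]]. Qed.

Lemma rsplit_no_r0 R w : no_r w -> rsplit (EVNode None R) w = None.
Proof. by case: w => [|[[]]]. Qed.

Lemma adjRw_no_r e w : no_r w -> adjRw e w = w.
Proof. by case: w => [|[[]]]. Qed.

Lemma no_r_merge i x w : good (unzip1 w) -> no_r w -> (i < size w)%N -> no_r (merge_word i (x, w)).2.
Proof.
case: w => [|[[a|a] y] w] // /good_no_r nr _.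
case: i => [|[|i]] //=; first by rewrite adjRw_no_r.
by case: w nr => [|[]].
Qed.

(** Let u r_c v be the value that splits. Merging an l after it changes only v, and merging an r
    before it changes only u and the label of r_c, by the recursive forms of [lop] and [rop].
    Splitting thus commutes with every merge, up to a shift of position. *)
Lemma rsplitP x w j v : good (unzip1 w) -> rsplit x w = Some (j, v) ->
  [/\ (j <= size w)%N, (size v.2 = (size w).+1)%N, good (letters v), merge_word j v = (x, w)
    & forall i, (i < size w)%N -> rsplit (merge_word i (x, w)).1 (merge_word i (x, w)).2 =
        Some (if (i < j)%N then (j.-1, merge_word i v) else (j, merge_word i.+1 v))].
Proof.
elim: w x j v => [|[e y] w IH] x j v good_w.
  by case: x => [[[c u]|]] R //= [<- <-].
have [nr|] := boolP (no_r ((e, y) :: w)).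
  case: x => [[[c u]|]] R; last by rewrite rsplit_no_r0.
  rewrite rsplit_no_r // => -[<- <-].
  case: e good_w nr => // a good_w _; have nr := good_no_r good_w; split=> //.
    exact: good_cons.
  case=> [|i] lt_i; rewrite ltn0; first by rewrite /merge_word /= adjRw_no_r // rsplit_no_r.
  by case: i w {IH good_w nr lt_i} => [|i] [|[]].
case: e good_w => // b; rewrite -[unzip1 _]/([:: inr b] ++ unzip1 w) good_cat.
case/and3P=> _ _ good_w _; rewrite rsplit_r.
case Dv: (rsplit y w) => [[j' v']|] //= [<- <-].
have [j'v szv gv' Mj Mi] := IH _ _ _ good_w Dv.
split=> [||||[|i] lt_i]; rewrite ?ltnS ?szv //.
- by rewrite /= szv.
- exact: (good_cons b gv').
- by rewrite merge_r Mj.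
- rewrite /=; case: w {IH good_w Mj Mi szv lt_i j'v} Dv => [|[[a|c] z] w] /= Dv.
  + by case: y Dv => [[[c u]|]] R //= [<- <-].
  + by case: y Dv => [[[c u]|]] R //= [<- <-].
  + by case: rsplit Dv => [[k z']|] //= [<- <-].
- rewrite -[(x, _)]/(rcons_word x b (y, w)) !merge_r [X in rsplit X]/= [X in rsplit _ X]/= rsplit_r.
  by rewrite Mi //; case: ltnP => //= lt_j; rewrite prednK //; lia.
Qed.

(** [j] is the position of the last r. Merging it makes a value rooted at that very r, which splits
    back; any other merge keeps an r in the word and leaves the value after the last r without an r
    at its root. *)
Lemma rsplitN x w : good (unzip1 w) -> rsplit x w = None -> ~~ no_r w ->
  exists2 j, (j < size w)%N & 
    (rsplit (merge_word j (x, w)).1 (merge_word j (x, w)).2 = Some (j, (x, w)) /\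
    forall i, i != j -> (i < size w)%N -> split_word (merge_word i (x, w)) = None).
Proof.
elim: w x => [|[[a|b] y] w IH] x good_w // Dx _.
move: good_w Dx; rewrite -[unzip1 _]/([:: inr b] ++ unzip1 w) good_cat.
case/and3P=> _ _ good_w; rewrite rsplit_r; case Dy: rsplit => // _.
have [nr|r] := boolP (no_r w).
  exists 0%N => //; case: y Dy => [[[c u]|]] R; first by rewrite rsplit_no_r.
  move=> _; split; first by rewrite /merge_word /= adjRw_no_r // rsplit_no_r.
  case=> // i _ lt_i; rewrite -[(x, _)]/(rcons_word x b (EVNode None R, w)) merge_r.
  rewrite /split_word rsplit_r; case Dm: merge_word => [z w'].
  have nr' : no_r w' by have := no_r_merge (EVNode None R) good_w nr lt_i; rewrite Dm.
  case: w i nr good_w lt_i Dm {IH} => [|[[a|//] t] w] // [|i] _ good_w _ [<- _].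
    by rewrite rsplit_no_r0.
  by rewrite rsplit_no_r0.
have [j lt_j [Mj Mi]] := IH y good_w Dy r.
exists j.+1 => //; rewrite -[(x, _)]/(rcons_word x b (y, w)); split=> [|[|i] nij lt_i].
- by rewrite merge_r rsplit_r /= -/(merge_word j _) Mj.
- case: w r good_w Dy {IH lt_j Mj Mi lt_i} => [|[[a|c] z] w] //= _ _.
  by rewrite /split_word /=; case: rsplit => [[]|].
- rewrite merge_r /split_word rsplit_r /=.
  by have := Mi i nij lt_i; rewrite /split_word -/(merge_word i _); case: rsplit.
Qed.

(** A matching of words: either [v] splits, compatibly with its merges, or it has a single merge
    that splits, and that one splits back into [v]. The condition on [wsum v] excludes the bare leaf
    with no letter, which is unmatched. *)
Lemma split_wordP v : good (letters v) -> wsum v != 1%N ->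
  (exists j v', [/\ split_word v = Some (j, v'), (j <= size v.2)%N, size v'.2 = (size v.2).+1,
      good (letters v') & merge_word j v' = v /\
      forall i, (i < size v.2)%N -> split_word (merge_word i v) =
        Some (if (i < j)%N then (j.-1, merge_word i v') else (j, merge_word i.+1 v'))]) \/
  (split_word v = None /\ exists2 j, (j < size v.2)%N &
      split_word (merge_word j v) = Some (j, v) /\
      forall i, i != j -> (i < size v.2)%N -> split_word (merge_word i v) = None).
Proof.
case: v => x w /(id : _ -> good (unzip1 w)) good_v v1; rewrite /split_word.
case Dv: (rsplit x w) => [[j v']|].
  have [le_j szv gv' Mj Mi] := rsplitP good_v Dv.
  left; exists j, v'; split=> //; split=> // i lt_i.
  by rewrite Mi //; case: ifP.
have [nr|r] := boolP (no_r w); last first.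
  have [j lt_j [Mj Mi]] := rsplitN good_v Dv r.
  right; split; first by case: w r {lt_j Mj Mi good_v v1 Dv} => [|[[]]].
  by exists j => //; rewrite Mj.
case: x Dv v1 => [[[c u]|]] R; first by rewrite rsplit_no_r.
move=> _; case: R => [[c u]|] v1.
  left; exists 0%N, (ev1 gamma, (inl c, u) :: w); split=> //.
  - by case: w nr {v1 good_v} => [|[[]]].
  - rewrite -[letters _]/([:: inl c] ++ unzip1 w) good_cat good_v !andbT.
    case: w nr good_v {v1} => [|[[a|//] y] w] // _ good_v.
    rewrite allrel1l.
    apply/allP => _ /mapP[e /predU1P[->|ew] ->] //.
    by have /allP/(_ _ ew) /= -> := @good_l _ [::] _ _ good_v.
  split; first by rewrite /merge_word /= adjRw_no_r.
  case: w nr good_v {v1} => [|[[a|//] y] w] // _ good_v.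
  have nr := good_no_r good_v.
  case=> [|i] lt_i; rewrite ltn0; first by rewrite /merge_word /= adjRw_no_r // rsplit_no_r0 //;
    case: w nr {good_v lt_i} => [|[[]]].
  by case: i w {good_v nr lt_i} => [|i] [|[]].
(* The first value is a leaf followed by l's only; merging the first l gives | l_a y, the shape
   undone by [lsplit]. *)
right; split; first by case: w nr {v1 good_v} => [|[[]]].
case: w nr good_v v1 => [|[[a|//] y] w] // _ good_v _; have nr := good_no_r good_v.
exists 0%N => //; split.
  by rewrite /merge_word /= adjRw_no_r // rsplit_no_r0 //; case: w nr {good_v} => [|[[]]].
by case=> // i _ _; case: i w {good_v nr} => [|i] [|[]].
Qed.
End Homotopy.

(** * The Koszul differential on the dual basis *)

Section TwoLevel.
Variable E : finType.
Implicit Types (t : ftree E) (ps : seq (ftree E)).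

Lemma skel_plug t ps : size ps = leaves t -> skel (plug t ps) = t.
Proof.
elim: t ps => [[]|e l IHl r IHr] ps //= sz.
rewrite IHl ?IHr ?size_drop ?size_takel ?sz ?leavesN ?addKn //.
exact: leq_addr.
Qed.

Lemma tops_plug t ps : size ps = leaves t -> tops (plug t ps) = ps.
Proof.
elim: t ps => [[]|e l IHl r IHr] ps /=.
  by case: ps => [|? []].
move=> sz; rewrite IHl ?IHr ?cat_take_drop // ?size_drop ?size_takel ?sz ?leavesN ?addKn //.
exact: leq_addr.
Qed.

Lemma arity_tops (c : ctree E) : arity (@leaves E) c = sumn (map (@leaves E) (tops c)).
Proof. by elim: c => [p|e l IHl r IHr] /=; rewrite ?addn0 // map_cat sumn_cat IHl IHr. Qed.

Lemma nodes_skel (c : ctree E) : nodes (skel c) = nodes c.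
Proof. by elim: c => //= e l -> r ->. Qed.

Definition cor e : ftree E := Node e Lf Lf.

(* The triples [(i, e, u)] with [t = graft i.+1 u (cor e)]. *)
Fixpoint cherries t : seq (nat * E * ftree E) :=
  match t with
  | Leaf _ => [::]
  | Node e l r =>
      (if (l, r) is (Leaf _, Leaf _) then [:: (0%N, e, Lf)] else [::]) ++
      [seq (v.1.1, v.1.2, Node e v.2 r) | v <- cherries l] ++
      [seq ((leaves l + v.1.1)%N, v.1.2, Node e l v.2) | v <- cherries r]
  end.

Lemma cherriesP t v : v \in cherries t ->
  (v.1.1 < leaves v.2)%N /\ graft v.1.1.+1 v.2 (cor v.1.2) = t.
Proof.
elim: t v => [[]|e l IHl r IHr] v //; rewrite [cherries _]/= !mem_cat => /or3P[].
- by case: l {IHl} => [[]|//]; case: r {IHr} => [[]|//]; rewrite inE => /eqP->.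
- case/mapP=> u /IHl[lt_u gu] -> /=; rewrite leavesN; split.
    exact: leq_trans lt_u (leq_addr _ _).
  by rewrite lt_u gu.
- case/mapP=> u /IHr[lt_u gu] -> /=; rewrite leavesN; split; first by rewrite ltn_add2l.
  by rewrite ltnNge leq_addr /= -addnS addKn gu.
Qed.

Lemma mem_cherries i e t : (i < leaves t)%N -> (i, e, t) \in cherries (graft i.+1 t (cor e)).
Proof.
elim: t i => [[]|f l IHl r IHr] i; first by case: i => //; rewrite mem_seq1.
rewrite leavesN => lt_i /=; case: ifP => [lt_l|/negbT]; rewrite /= !mem_cat.
  apply/or3P/Or32; apply/mapP; exists (i, e, l) => //; exact: IHl.
rewrite -leqNgt => le_l; apply/or3P/Or33; apply/mapP.
exists ((i - leaves l)%N, e, r); last by rewrite /= subnKC.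
by rewrite subSn //; apply: IHr; rewrite ltn_subLR.
Qed.

Lemma uniq_cherries t : uniq (cherries t).
Proof.
apply: (@map_uniq _ _ (fun v => v.1.1)).
elim: t => [[]|e l IHl r IHr] //=; rewrite !map_cat -!map_comp.
have -> : [seq ((fun v => v.1.1) \o (fun v => (v.1.1, v.1.2, Node e v.2 r))) i | i <- cherries l]
   = [seq v.1.1 | v <- cherries l] by apply: eq_map.
have -> : [seq ((fun v => v.1.1) \o (fun v => ((leaves l + v.1.1)%N, v.1.2, Node e l v.2))) i
    | i <- cherries r] = map (addn (leaves l)) [seq v.1.1 | v <- cherries r].
  by rewrite -map_comp; apply: eq_map.
rewrite cat_uniq cat_uniq IHl (map_inj_uniq (@addnI (leaves l))) IHr.
rewrite !andbT; apply/and3P; split.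
- by case: l {IHl} => [[]|? ? ?] //; case: r {IHr} => [[]|].
- by case: l {IHl} => [[]|? ? ?]; [case: r {IHr} => [[]|? ? ?] // |]; apply/hasPn => z.
- apply/hasPn => k /mapP[j _ ->]; apply/negP => /mapP[v /cherriesP[lt_v gv] Dk].
  have: (leaves l <= leaves v.2)%N by apply: ltnW; rewrite (leq_ltn_trans _ lt_v) // -Dk leq_addr.
  by rewrite -gv leaves_graft /cor leavesN leavesLf addn2 /= ltnn.
Qed.

(** The number of nodes that precede, in preorder, a node grafted on leaf [i]; here, unlike in
    [graft], leaves are numbered from 0. *)
Fixpoint nbefore i t : nat :=
  match t with
  | Leaf _ => 0
  | Node _ l r => if (i < leaves l)%N then (nbefore i l).+1
                  else ((nodes l + nbefore (i - leaves l) r).+1)%N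
  end.

Lemma size_mrg (A : Type) (op : A -> A -> A) i (s : seq A) :
  (i.+1 < size s)%N -> size (mrg op i s) = (size s).-1.
Proof.
elim: s i => [|x [|y s] IH] [|i] //=; rewrite ltnS => lt_i.
by rewrite (IH i).
Qed.

Lemma mrg_catl (A : Type) (op : A -> A -> A) i (s u : seq A) :
  (i.+1 < size s)%N -> mrg op i (s ++ u) = mrg op i s ++ u.
Proof.
elim: s i => [|x [|y s] IH] [|i] //=; rewrite ltnS => lt_i.
by rewrite -(IH i).
Qed.

Lemma mrg_catr (A : Type) (op : A -> A -> A) i (s u : seq A) : (i.+1 < size u)%N ->
  mrg op (size s + i) (s ++ u) = s ++ mrg op i u.
Proof.
move=> lt_i; elim: s => [|x s IH] //=; rewrite -IH.
by case: s {IH} => [|y s] //=; case: u lt_i.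
Qed.

Lemma kterms_plug t ps : size ps = leaves t ->
  kterms (plug t ps) = [seq (nbefore v.1.1 v.2, plug v.2 (mrg (Node v.1.2) v.1.1 ps))
                          | v <- cherries t].
Proof.
elim: t ps => [[]|e l IHl r IHr] ps //; rewrite leavesN => sz.
have [psl [psr [Dps szl szr]]] : exists psl psr,
    [/\ ps = psl ++ psr, size psl = leaves l & size psr = leaves r].
  exists (take (leaves l) ps), (drop (leaves l) ps).
  by rewrite cat_take_drop size_drop size_takel sz ?leq_addr // addKn.
rewrite {ps sz}Dps /= -szl take_size_cat // drop_size_cat // szl !map_cat; congr (_ ++ (_ ++ _)).
- case: l {IHl IHr} psl szl => [[]|? ? ?] [|p [|p' psl]] //= _; case: r psr szr => [[]|? ? ?] //.
  by case=> [|q []].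
- rewrite IHl // -!map_comp; apply/eq_in_map => v /cherriesP[lt_v gv] /=; rewrite lt_v.
  have lv : leaves l = (leaves v.2).+1.
    by rewrite -gv leaves_graft /cor leavesN leavesLf addn2.
  have lt_s : (v.1.1.+1 < size psl)%N by rewrite szl lv ltnS.
  rewrite mrg_catl // take_size_cat ?drop_size_cat ?size_mrg ?szl ?lv //.
- rewrite IHr // -!map_comp; apply/eq_in_map => v /cherriesP[lt_v gv] /=.
  have lv : leaves r = (leaves v.2).+1.
    by rewrite -gv leaves_graft /cor leavesN leavesLf addn2.
  have lt_s : (v.1.1.+1 < size psr)%N by rewrite szr lv ltnS.
  rewrite ltnNge leq_addr /= addKn nodes_plug // -szl mrg_catr //.
  by rewrite take_size_cat // drop_size_cat.
Qed.

End TwoLevel.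

Section Omega.
Variables (K : fieldType) (gamma : nat).
Local Notation E := (dup_gen gamma).
Implicit Types (e f : E) (s : seq E) (t u : ftree E) (ps : seq (ftree E)).

(** The two exponents differ by an even number, so after rescaling by [sg] the preorder sign of the
    differential becomes the alternating sign of the position. *)
Lemma sign_cherry i e t : (i < leaves t)%N ->
  (-1) ^+ sg (graft i.+1 t (cor e)) * (-1) ^+ nbefore i t = (-1) ^+ i * (-1) ^+ sg t :> K.
Proof.
rewrite -!exprD => lt_i.
suff [q ->] : exists q, (sg (graft i.+1 t (cor e)) + nbefore i t = i + sg t + q.*2)%N.
  by rewrite exprD -muln2 exprM sqrr_sign mulr1.
elim: t i lt_i => [[]|f l IHl r IHr] i; first by case: i => // _; exists 0%N.
rewrite leavesN /= => lt_i; case: ltnP => [lt_l|le_l] /=.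
  have [q Dq] := IHl _ lt_l; exists q.+1; rewrite nodes_graft /=.
  by move: Dq; set x := sg _; set y := nbefore _ _; lia.
have [|q] := IHr (i - leaves l)%N; first by rewrite ltn_subLR.
rewrite -subSn // => Dq; exists q.
by move: Dq le_l; rewrite (succ_nodes l); set x := sg (graft _ _ _); set y := nbefore _ _; lia.
Qed.

(** A tree with a distinguished topmost node amounts to a position, a letter and the smaller tree on
    which this letter is grafted. *)
Lemma cherry_sum k (V : nmodType) (F : nat -> E -> ftree E -> V) :
  \sum_(t : ntree E k.+2) \sum_(v <- cherries t) F v.1.1 v.1.2 v.2 =
  \sum_(i < k.+1) \sum_(e : E) \sum_(t : ntree E k.+1) F i e t.
Proof.
pose P := ('I_k.+1 * E * ntree E k.+1)%type.
pose g (p : P) : nat * E * ftree E := (val p.1.1, p.1.2, val p.2).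
have gP (t : ntree E k.+2) : perm_eq (cherries t)
    [seq g p | p <- enum [pred p : P | graft (val p.1.1).+1 (val p.2) (cor p.1.2) == val t]].
  apply: uniq_perm; first exact: uniq_cherries.
    rewrite map_inj_uniq ?enum_uniq // => -[[i e] u] [[j f] v] [] ij -> uv.
    by congr (_, _, _); exact: val_inj.
  move=> [[i e] u]; apply/idP/mapP => [/cherriesP[/= lt_i gu]|[p]].
    have lu : leaves u == k.+1.
      have := eqP (tree_ofP t); rewrite -[tree_of t]gu leaves_graft /cor leavesN leavesLf.
      by rewrite addn2 => -[->].
    rewrite (eqP lu) in lt_i; exists (Ordinal lt_i, e, NTree lu) => //.
    by rewrite mem_enum inE /= gu.
  rewrite mem_enum inE => /eqP pt -> /=.
  have := mem_cherries p.1.2 (_ : (val p.1.1 < leaves (val p.2))%N).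
  have -> : leaves (val p.2) = k.+1 by exact/eqP/tree_ofP.
  by rewrite pt; apply; exact: ltn_ord.
under eq_bigr => t _.
  rewrite (perm_big _ (gP t)) big_map big_enum /=.
  over.
rewrite (exchange_big_dep xpredT) //=.
under eq_bigr => p _.
  have gp : leaves (graft (val p.1.1).+1 (val p.2) (cor p.1.2)) == k.+2.
    by rewrite leaves_graft (eqP (tree_ofP p.2)) /cor leavesN leavesLf addn2.
  rewrite (big_pred1 (NTree gp)) => [|t]; last by rewrite /= inE -val_eqE eq_sym.
  over.
rewrite -(pair_bigA _ (fun ie (t : ntree E k.+1) => F (val ie.1) ie.2 (tree_of t))).
by rewrite -(pair_bigA _ (fun i e => \sum_(t : ntree E k.+1) F (val i) e (tree_of t))).
Qed.

Definition omega k n s ps : Free2 K E k n :=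
  \sum_(t : ntree E k.+1) (wvect K k.+1 s t : K) *: cvec K k n (plug t ps).

Lemma fits_cor e f : fits (cor e) [:: f] = (e == f).
Proof. by rewrite /= andbT; case: f. Qed.

(** This is [fits_graft] for a block of one letter: the node detached at position [i] must be the
    letter of index [i] of the word, and the rest must fit the contracted word. *)
Lemma kdiff0_omega k n s ps e0 : good s -> size s = k.+1 -> size ps = k.+2 ->
  kdiff0 (omega k.+1 n s ps) =
  \sum_(i < k.+1) (-1) ^+ i *:
    omega k n (contract (take i s) (take 1 (drop i s)) (drop i.+1 s))
              (mrg (Node (nth e0 s i)) i ps).
Proof.
move=> good_s szs szp; rewrite /omega linear_sum /=.
transitivity (\sum_(t : ntree E k.+2) \sum_(v <- cherries t)
  ((-1) ^+ sg (graft v.1.1.+1 v.2 (cor v.1.2)) *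
   (fits (graft v.1.1.+1 v.2 (cor v.1.2)) s)%:R * (-1) ^+ nbefore v.1.1 v.2 : K) *:
   cvec K k n (plug v.2 (mrg (Node v.1.2) v.1.1 ps))).
  apply: eq_bigr => t _; rewrite linearZ /= kdiff0_cvec /kbasis kterms_plug; last first.
    by rewrite szp (eqP (tree_ofP t)).
  rewrite big_map scaler_sumr !big_seq; apply: eq_bigr => v /cherriesP[_ ->].
  by rewrite ffunE scalerA.
rewrite (cherry_sum k (fun i e u => ((-1) ^+ sg (graft i.+1 u (cor e)) *
   (fits (graft i.+1 u (cor e)) s)%:R * (-1) ^+ nbefore i u : K) *:
   cvec K k n (plug u (mrg (Node e) i ps)))).
apply: eq_bigr => i _; rewrite scaler_sumr exchange_big /=; apply: eq_bigr => t _.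
set s1 := take i s; set b := take 1 _; set s2 := drop _ s.
have Ds : s1 ++ b ++ s2 = s.
  by rewrite /s2 -[i.+1]add1n -drop_drop !cat_take_drop.
have lt_i : (i < size s)%N by rewrite szs.
have Db : b = [:: nth e0 s i] by rewrite /b (drop_nth e0) //= take0.
have fitsE e : fits (graft i.+1 t (cor e)) s = fits t (contract s1 b s2) && (e == nth e0 s i).
  have sz1 : size s1 = i by rewrite size_takel // ltnW.
  rewrite -{1}Ds -{1}sz1 fits_graft ?Ds //.
  - by rewrite Db fits_cor.
  - by rewrite Db.
  - by rewrite sz1 size_drop szs; apply: succn_inj; rewrite -succ_nodes (eqP (tree_ofP t));
      have := ltn_ord i; lia.
rewrite (bigD1 (nth e0 s i)) //= big1 ?addr0 => [|e ne]; last first.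
  by rewrite fitsE (negPf ne) andbF mulr0 mul0r scale0r.
rewrite fitsE eqxx andbT scalerA mulrAC sign_cherry; last first.
  by rewrite (eqP (tree_ofP t)).
by rewrite ffunE mulrA.
Qed.

End Omega.

(** * Acyclicity *)

Section Spanp.
Variables (K : fieldType).

Lemma spanp0 (V : vectType K) (S : V -> Prop) : 0 \in spanp S.
Proof. exact: (spanp_submod_closed S).1. Qed.

Lemma spanpN (V : vectType K) (S : V -> Prop) x : x \in spanp S -> - x \in spanp S.
Proof. by move=> Sx; rewrite -scaleN1r spanpZ. Qed.

Lemma spanpB (V : vectType K) (S : V -> Prop) x y :
  x \in spanp S -> y \in spanp S -> x - y \in spanp S.
Proof. by move=> Sx Sy; rewrite spanpD ?spanpN. Qed.

Lemma spanp_ker (V W : vectType K) (S : V -> Prop) (f : {linear V -> W}) :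
  (forall x, S x -> f x = 0) -> forall x, x \in spanp S -> f x = 0.
Proof.
move=> f0 x /asboolP Sx; suff: x \in lker (linfun f) by rewrite memv_ker lfunE => /eqP.
by apply: Sx => s /f0 fs0; rewrite memv_ker lfunE /= fs0.
Qed.
End Spanp.

Section Extension.
Variables (K : fieldType) (E : finType) (k n : nat) (V : lmodType K) (g : ctree E -> V).

Definition ext (X : Free2 K E k n) : V := \sum_(c : nctree E k n) (X c : K) *: g c.

Fact ext_is_linear : linear ext.
Proof.
move=> a x y; rewrite /ext scaler_sumr -big_split; apply: eq_bigr => c _ /=.
by rewrite !ffunE scalerDl scalerA.
Qed.
HB.instance Definition _ := GRing.isLinear.Build K (Free2 K E k n) V *:%R ext ext_is_linear.

Definition cvalid (c : ctree E) := (nodes c == k) && (arity (@leaves E) c == n).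

Lemma ext_cvec c : cvalid c -> ext (cvec K k n c) = g c.
Proof. exact: (sum_bvec (nctree E k n) g). Qed.

Lemma cvec_invalid c : ~~ cvalid c -> cvec K k n c = 0.
Proof. exact: bvec0. Qed.
End Extension.

Section Complex.
Variables (K : fieldType) (gamma : nat).
Local Notation E := (dup_gen gamma).
Local Notation word := (evtree gamma * seq (E * evtree gamma))%type.
Implicit Types (s : seq E) (t : ftree E) (ps : seq (ftree E)) (v : word).
Local Notation ideal k n := (spanp (@ideal_tensor K E (dup_rel K gamma) k n)).

Lemma sum_fvecB m t u (V : lmodType K) (f : ftree E -> V) : leaves t = m -> leaves u = m ->
  \sum_(q : ntree E m) ((fvec K m t - fvec K m u) q : K) *: f q = f t - f u.
Proof.
move=> /eqP tm /eqP um; rewrite -(sum_bvec (ntree E m) f tm) -(sum_bvec (ntree E m) f um).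
by rewrite -sumrB; apply: eq_bigr => q _; rewrite !ffunE scalerBl.
Qed.

Definition nf t := reify (eval t).

Lemma arity_plug t ps : size ps = leaves t ->
  arity (@leaves E) (plug t ps) = sumn (map (@leaves E) ps).
Proof. by move=> sz; rewrite arity_tops tops_plug. Qed.

Lemma map_leaves_nf ps : map (@leaves E) (map nf ps) = map (@leaves E) ps.
Proof. by rewrite -map_comp; apply: eq_map => t /=; rewrite leaves_reify ev_nodes_eval. Qed.

Lemma cvec_nf k n t ps : size ps = leaves t ->
  cvec K k n (plug t ps) - cvec K k n (plug t (map nf ps)) \in ideal k n.
Proof.
suff nf_cat ps1 ps2 : (size ps1 + size ps2)%N = leaves t ->
  cvec K k n (plug t (ps1 ++ ps2)) - cvec K k n (plug t (ps1 ++ map nf ps2)) \in ideal k n.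
  exact: (nf_cat [::]).
elim: ps2 ps1 => [|q ps2 IH] ps1 /= sz; first by rewrite subrr spanp0.
rewrite -(subrKA (cvec K k n (plug t (rcons ps1 (nf q) ++ ps2)))) spanpD //; last first.
  by rewrite -(cat_rcons (nf q)) IH // size_rcons addSn -addnS.
rewrite cat_rcons; have [|C fC] := @plug_fill E t ps1 ps2; first by rewrite -sz addnS.
pose y := fvec K (leaves q) q - fvec K (leaves q) (nf q).
have Iy : y \in gen_ideal (dup_rel K gamma) (n := leaves q).
  by rewrite gen_ideal_eval linearB /= !eval_lin_fvec ?leaves_reify ?ev_nodes_eval //
    reifyK subrr.
have := fill_ideal k n C Iy.
rewrite (sum_fvecB (fun u => cvec K k n (fill C u))) ?leaves_reify ?ev_nodes_eval //.
by rewrite !fC.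
Qed.

(** Words are embedded in the two-level trees, as combs carrying normal forms, so that maps on words
    are maps on [Free2]. *)
Definition wvec k n v : Free2 K E k n :=
  cvec K k n (plug (comb (letters v)) (map (@reify gamma) (vals v))).

Definition wok k n v := [&& good (letters v), size v.2 == k & wsum v == n].

(** Reads a word off any two-level tree; it inverts the embedding [wvec] on good words. *)
Definition wd (c : ctree E) : word :=
  let xs := map (@eval gamma) (tops c) in
  (head (ev1 gamma) xs, zip (inw (skel c)) (behead xs)).

Lemma size_letters v : size (letters v) = size v.2.
Proof. exact: size_map. Qed.

Lemma size_vals v : size (vals v) = (size v.2).+1.
Proof. by rewrite /= size_map. Qed.

Lemma letters_wd c : letters (wd c) = inw (skel c).
Proof.
rewrite /letters unzip1_zip // size_inw size_behead size_map size_tops.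
by rewrite succ_nodes.
Qed.

Lemma vals_wd c : vals (wd c) = map (@eval gamma) (tops c).
Proof.
rewrite /vals /wd /= unzip2_zip; last by rewrite size_inw size_behead size_map size_tops succ_nodes.
by have := leaves_gt0 (skel c); rewrite -size_tops; case: (tops c).
Qed.

Lemma word_eq v v' : letters v = letters v' -> vals v = vals v' -> v = v'.
Proof.
case: v v' => x w [x' w'] /= eq1 [-> eq2]; congr pair.
by rewrite -(zip_unzip w) -(zip_unzip w') eq2; congr zip.
Qed.

Lemma wd_plug s ps : good s -> size ps = (size s).+1 ->
  letters (wd (plug (comb s) ps)) = s /\ vals (wd (plug (comb s) ps)) = map (@eval gamma) ps.
Proof.
move=> good_s sz; rewrite letters_wd vals_wd skel_plug ?tops_plug ?leaves_comb //.
by rewrite inw_comb.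
Qed.

Lemma wd_word v : good (letters v) ->
  wd (plug (comb (letters v)) (map (@reify gamma) (vals v))) = v.
Proof.
move=> good_v; have [|lv vv] := @wd_plug (letters v) (map (@reify gamma) (vals v)) good_v.
  by rewrite size_map size_vals size_letters.
apply: word_eq => //; rewrite vv -map_comp -[RHS]map_id; apply: eq_map => x /=.
exact: reifyK.
Qed.

Lemma wok_valid k n v : wok k n v ->
  cvalid k n (plug (comb (letters v)) (map (@reify gamma) (vals v))).
Proof.
case/and3P=> good_v /eqP szv /eqP <-; rewrite /cvalid.
have sz : size (map (@reify gamma) (vals v)) = leaves (comb (letters v)).
  by rewrite size_map size_vals leaves_comb // size_letters.
rewrite arity_plug // nodes_plug // nodes_comb // size_letters szv eqxx andTb.
by apply/eqP; rewrite /wsum -map_comp; congr sumn; apply: eq_map => x /=; rewrite leaves_reify.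
Qed.

Definition omega_map k n : Free2 K E k n -> Free2 K E k n :=
  ext (fun c => omega K k n (letters (wd c)) (map (@reify gamma) (vals (wd c)))).
HB.instance Definition _ k n := GRing.Linear.on (@omega_map k n).

Definition dmap k n : Free2 K E k.+1 n -> Free2 K E k n :=
  ext (fun c => \sum_(i < k.+1) (-1) ^+ i *: wvec k n (merge_word i (wd c))).
HB.instance Definition _ k n := GRing.Linear.on (@dmap k n).

Definition hmap k n : Free2 K E k n -> Free2 K E k.+1 n :=
  ext (fun c => if split_word (wd c) is Some (j, v) then (-1) ^+ j *: wvec k.+1 n v else 0).
HB.instance Definition _ k n := GRing.Linear.on (@hmap k n).

(** Only the coordinates at combs are kept, with their sign undone. Each word sum having one comb,
    this is a left inverse of [omega_map] on words. *)
Definition psi_map k n : Free2 K E k n -> Free2 K E k n :=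
  ext (fun c => if is_comb (skel c) then (-1) ^+ sg (skel c) *: wvec k n (wd c) else 0).
HB.instance Definition _ k n := GRing.Linear.on (@psi_map k n).

Section OnWords.
Variables (k n : nat) (v : word).
Hypothesis vok : wok k n v.

Lemma omega_wvec : omega_map (wvec k n v) = omega K k n (letters v) (map (@reify gamma) (vals v)).
Proof. by case/and3P: (vok) => gv _ _; rewrite /omega_map ext_cvec ?wok_valid // wd_word. Qed.

Lemma hmap_wvec : hmap (wvec k n v) =
  if split_word v is Some (j, v') then (-1) ^+ j *: wvec k.+1 n v' else 0.
Proof. by case/and3P: (vok) => gv _ _; rewrite /hmap ext_cvec ?wok_valid // wd_word. Qed.
End OnWords.

Lemma dmap_wvec k n v : wok k.+1 n v ->
  dmap (wvec k.+1 n v) = \sum_(i < k.+1) (-1) ^+ i *: wvec k n (merge_word i v).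
Proof. by move=> vok; case/and3P: (vok) => gv _ _; rewrite /dmap ext_cvec ?wok_valid // wd_word. Qed.

Definition is_word k n (X : Free2 K E k n) : Prop := exists2 v, wok k n v & X = wvec k n v.

Lemma wok_merge k n i v : (i < k.+1)%N -> wok k.+1 n v -> wok k n (merge_word i v).
Proof.
move=> lt_i /and3P[gv /eqP szv sv]; rewrite -szv in lt_i.
by rewrite /wok good_merge // size_merge_word // szv wsum_merge // eqxx.
Qed.

Lemma dmap_word k n (X : Free2 K E k.+1 n) : X \in spanp (@is_word k.+1 n) ->
  dmap X \in spanp (@is_word k n).
Proof.
apply: (spanp_lin (f := @dmap k n)) => _ [v vok ->]; rewrite /= dmap_wvec //.
apply: spanp_sum => i; apply/spanpZ/spanp_gen; exists (merge_word i v) => //.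
exact: wok_merge.
Qed.

Lemma wok_split k n v j v' : wok k n v -> n != 1%N -> split_word v = Some (j, v') -> wok k.+1 n v'.
Proof.
move=> /and3P[gv /eqP szv /eqP sv] n1 Dv.
have [|[i [u []]]|[]] := split_wordP gv; rewrite ?sv //; last by rewrite Dv.
rewrite Dv => -[<- <-] le_i szu gu [Mu _].
by rewrite /wok gu szu szv -sv -Mu wsum_merge ?szu ?eqxx.
Qed.

Lemma hmap_word k n (X : Free2 K E k n) : n != 1%N -> X \in spanp (@is_word k n) ->
  hmap X \in spanp (@is_word k.+1 n).
Proof.
move=> n1; apply: (spanp_lin (f := @hmap k n)) => _ [v vok ->]; rewrite /= hmap_wvec //.
case Dv: split_word => [[j v']|]; last exact: spanp0.
apply/spanpZ/spanp_gen; exists v' => //; exact: wok_split Dv.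
Qed.

Lemma homotopy0 n (X : Free2 K E 0 n) : n != 1%N -> X \in spanp (@is_word 0 n) ->
  dmap (hmap X) = X.
Proof.
move=> n1 wX; apply/eqP; rewrite -subr_eq0; apply/eqP.
pose f := (linfun (@dmap 0 n) \o linfun (@hmap 0 n) - \1)%VF.
suff: f X = 0 by rewrite !lfun_simp.
apply: spanp_ker wX => _ [v vok ->]; rewrite /f /= !lfun_simp /=.
apply/eqP; rewrite subr_eq0 hmap_wvec //; apply/eqP.
have /and3P[gv /eqP szv /eqP sv] := vok.
have [|[j [u [Dv le_j szu gu [Mu _]]]]|[_ [j]]] := split_wordP gv; rewrite ?sv ?szv //.
rewrite Dv linearZ /= dmap_wvec; last exact: wok_split Dv.
rewrite szv leqn0 in le_j; rewrite (eqP le_j) in Mu *.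
by rewrite big_ord_recl big_ord0 addr0 Mu !scale1r.
Qed.

Lemma homotopyS k n (X : Free2 K E k.+1 n) : n != 1%N -> X \in spanp (@is_word k.+1 n) ->
  dmap (hmap X) + hmap (dmap X) = X.
Proof.
move=> n1 wX; apply/eqP; rewrite -subr_eq0; apply/eqP.
pose f := ((linfun (@dmap k.+1 n) \o linfun (@hmap k.+1 n)) +
           (linfun (@hmap k n) \o linfun (@dmap k n)) - \1)%VF.
suff: f X = 0 by rewrite !lfun_simp.
apply: spanp_ker wX => _ [v vok ->]; rewrite /f /= !lfun_simp /=.
apply/eqP; rewrite subr_eq0 hmap_wvec // dmap_wvec //; apply/eqP.
have /and3P[gv /eqP szv /eqP sv] := vok.
rewrite linear_sum /=; under [X in _ + X]eq_bigr => i _.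
  rewrite linearZ /= hmap_wvec ?wok_merge //; over.
have := split_wordP gv; rewrite sv szv => /(_ n1).
case=> [[j [u [Dv le_j szu gu [Mu Mi]]]]|[Dv [j lt_j [Mj Mi]]]].
- have uok : wok k.+2 n u by exact: wok_split Dv.
  rewrite Dv linearZ /= dmap_wvec // -ltnS in le_j *.
  (* Merging the split word at [j] restores [v] with sign +1. Each other merge of it cancels against
     a term of [hmap (dmap v)], since exactly one of the two positions is shifted by one. *)
  rewrite (bigD1_ord (Ordinal le_j)) //= Mu scalerDr scalerA -expr2 sqrr_sign scale1r.
  rewrite -addrA [X in _ + X](_ : _ = 0) ?addr0 // scaler_sumr -big_split big1 //= => i _.
  rewrite Mi // /bump leqNgt; case: ltnP => lt_ij /=; rewrite !scalerA -!exprD -scalerDl.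
    have [j' Dj] : exists j', j = j'.+1 by case: (j) lt_ij => // j'; exists j'.
    by rewrite Dj /= add0n addSn exprS mulN1r addnC addNr scale0r.
  by rewrite add1n addnS exprS mulN1r addnC addNr scale0r.
- rewrite Dv linear0 add0r (bigD1 (Ordinal lt_j)) //= Mj scalerA -expr2 sqrr_sign scale1r.
  by rewrite big1 ?addr0 // => i ij; rewrite Mi ?scaler0.
Qed.

Lemma wvec_wd k n c : is_comb (skel c) ->
  wvec k n (wd c) = cvec K k n (plug (skel c) (map nf (tops c))).
Proof.
case/is_combP=> s good_s Dc; rewrite /wvec letters_wd vals_wd Dc inw_comb //.
by rewrite -map_comp.
Qed.

Lemma psi_word k n (X : Free2 K E k n) : psi_map X \in spanp (@is_word k n).
Proof.
apply: spanp_sum => c; apply: spanpZ; case: ifP => [comb_c|_]; last exact: spanp0.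
apply/spanpZ/spanp_gen; exists (wd c) => //.
have /andP[/eqP kc /eqP nc] := ctree_ofP c.
have szw : size (wd c).2 = k by rewrite -size_letters letters_wd size_inw nodes_skel kc.
rewrite /wok szw eqxx letters_wd; case/andP: (comb_c) => -> _; rewrite !andTb.
apply/eqP; rewrite /wsum vals_wd -[RHS]nc arity_tops -map_comp; congr sumn.
by apply: eq_map => t /=; rewrite ev_nodes_eval.
Qed.

Lemma psi_plug k n t ps : size ps = leaves t ->
  psi_map (cvec K k n (plug t ps)) =
  if is_comb t then (-1) ^+ sg t *: cvec K k n (plug t (map nf ps)) else 0.
Proof.
move=> sz; have [vt|nvt] := boolP (cvalid k n (plug t ps)).
  rewrite /psi_map ext_cvec // skel_plug //; case: ifP => // comb_t.
  by rewrite wvec_wd skel_plug ?tops_plug.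
rewrite cvec_invalid // linear0; case: ifP => // _; rewrite cvec_invalid ?scaler0 //.
by move: nvt; rewrite /cvalid !nodes_plug ?arity_plug ?size_map // map_leaves_nf.
Qed.

(** [psi_map] sees the upper trees only through their values, on which the ideal is zero. *)
Lemma psi_ideal k n (X : Free2 K E k n) : X \in ideal k n -> psi_map X = 0.
Proof.
apply: spanp_ker => _ [m z ps1 y ps2 sz Iy].
rewrite /ctensor linear_sum big1 // => t _; rewrite linear_sum /=.
under eq_bigr => q _.
  rewrite linearZ /= psi_plug; last by rewrite (eqP (tree_ofP t)) size_cat /= addnS sz.
  over.
case: (is_comb t); last by rewrite big1 // => q _; rewrite scaler0.
under eq_bigr => q _ do rewrite -scalerA map_cat /=.
rewrite -scaler_sumr (eval_lin_factor (fun e => (-1) ^+ sg t *: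
  cvec K k n (plug t (map nf ps1 ++ reify e :: map nf ps2)))).
move: Iy; rewrite gen_ideal_eval => /eqP ->.
by rewrite big1 ?scaler0 // => u _; rewrite ffunE scale0r.
Qed.

Lemma omega_invalid k n s ps : size ps = k.+1 -> sumn (map (@leaves E) ps) != n ->
  omega K k n s ps = 0.
Proof.
move=> sz nps; rewrite /omega big1 // => t _; rewrite cvec_invalid ?scaler0 //.
by rewrite /cvalid arity_plug ?(negPf nps) ?andbF // (eqP (tree_ofP t)).
Qed.

Lemma psi_omega k n s ps : good s -> size s = k -> size ps = k.+1 ->
  psi_map (omega K k n s ps) = cvec K k n (plug (comb s) (map nf ps)).
Proof.
move=> good_s szs szp; rewrite /omega linear_sum /=.
have lc : leaves (comb s) == k.+1 by rewrite leaves_comb // szs.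
rewrite (bigD1 (NTree lc)) //= big1 ?addr0 => [|t tc]; last first.
  rewrite linearZ /= psi_plug ?szp ?(eqP (tree_ofP t)) //.
  case: ifP => [/is_combP[s' good_s' Dt]|_]; last exact: scaler0.
  rewrite ffunE Dt fits_comb // (_ : s == s' = false) ?mulr0 ?scale0r //.
  by apply: contraNF tc => /eqP ss'; rewrite -val_eqE /= Dt ss'.
rewrite linearZ /= psi_plug ?szp ?(eqP lc) // (_ : is_comb _); last by apply/is_combP; exists s.
by rewrite ffunE /= fits_comb // eqxx mulr1 scalerA -expr2 sqrr_sign scale1r.
Qed.

Lemma omega_nf k n s ps : size ps = k.+1 ->
  omega K k n s ps - omega K k n s (map nf ps) \in ideal k n.
Proof.
move=> szp; rewrite /omega -sumrB; apply: spanp_sum => t; rewrite -scalerBr.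
by apply/spanpZ/cvec_nf; rewrite szp (eqP (tree_ofP t)).
Qed.

Lemma psi_omega_map k n (X : Free2 K E k n) : X \in spanp (@is_word k n) ->
  psi_map (omega_map X) = X.
Proof.
move=> wX; apply/eqP; rewrite -subr_eq0; apply/eqP.
pose f := ((linfun (@psi_map k n) \o linfun (@omega_map k n)) - \1)%VF.
suff: f X = 0 by rewrite !lfun_simp.
apply: spanp_ker wX => _ [v vok ->]; rewrite /f /= !lfun_simp /= omega_wvec //.
have /and3P[gv /eqP szv _] := vok.
rewrite psi_omega ?size_letters // ?size_map ?size_vals ?szv // -map_comp.
rewrite (eq_map (g := @reify gamma)); first exact: subrr.
by move=> x /=; rewrite /nf reifyK.
Qed.

Lemma omega_psi k n s ps : good s -> size s = k -> size ps = k.+1 ->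
  omega K k n s ps - omega_map (psi_map (omega K k n s ps)) \in ideal k n.
Proof.
move=> good_s szs szp.
have [nps|nps] := eqVneq (sumn (map (@leaves E) ps)) n; last first.
  by rewrite omega_invalid // 2!linear0 subrr spanp0.
have [lv vv] := wd_plug good_s (etrans szp (congr1 succn (esym szs))).
set v := wd _ in lv vv.
have vok : wok k n v.
  rewrite /wok lv good_s -size_letters lv szs eqxx /wsum vv -map_comp /= -nps.
  by apply/eqP; congr sumn; apply: eq_map => t /=; rewrite ev_nodes_eval.
have -> : psi_map (omega K k n s ps) = wvec k n v.
  by rewrite psi_omega // /wvec lv vv -map_comp.
by rewrite omega_wvec // lv vv -map_comp; exact: omega_nf.
Qed.

(** By the expansion of the dual into word sums, it suffices to treat [omega], for which the round
    trip merely puts the upper trees in normal form. *)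
Lemma dual_psi k n (y : Free2 K E k n) :
    y \in spanp (@dual_tensor K E (dup_rel K gamma) k n) ->
  y - omega_map (psi_map y) \in ideal k n.
Proof.
pose f := (\1 - (linfun (@omega_map k n) \o linfun (@psi_map k n)))%VF.
have fE x : f x = x - omega_map (psi_map x) by rewrite /f !lfun_simp.
rewrite -fE; apply: (spanp_lin (f := f)) => _ [m z ps1 x ps2 sz /koszul_dual_expand Dz].
suff f_dual q : f (\sum_(t : ntree E k.+1) (z t : K) *:
    cvec K k n (plug t (ps1 ++ q :: ps2))) \in ideal k n.
  rewrite /= /ctensor exchange_big linear_sum; apply: spanp_sum => q /=.
  under eq_bigr => t _ do rewrite mulrC -scalerA.
  by rewrite -scaler_sumr linearZ; apply/spanpZ/f_dual.
have -> : \sum_(t : ntree E k.+1) (z t : K) *: cvec K k n (plug t (ps1 ++ q :: ps2)) =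
    \sum_(s <- good_words gamma k) scoef z (comb s) *: omega K k n s (ps1 ++ q :: ps2).
  under [RHS]eq_bigr => s _ do rewrite scaler_sumr.
  rewrite exchange_big /=; apply: eq_bigr => t _.
  rewrite {1}Dz sum_ffunE scaler_suml; apply: eq_bigr => s _.
  by rewrite ffunE scalerA.
rewrite linear_sum big_seq; apply: (big_ind (fun x => x \in ideal k n)) => [|u u'|s];
  [exact: spanp0 | exact: spanpD |].
rewrite mem_good_words => /andP[good_s /eqP szs].
rewrite linearZ; apply: spanpZ; rewrite /= fE; apply: omega_psi => //.
by rewrite size_cat /= addnS sz.
Qed.

Lemma omega_map_dual k n (X : Free2 K E k n) : X \in spanp (@is_word k n) ->
  omega_map X \in spanp (@dual_tensor K E (dup_rel K gamma) k n).
Proof.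
apply: (spanp_lin (f := @omega_map k n)) => _ [v vok ->]; rewrite /= omega_wvec //.
have /and3P[gv /eqP szv _] := vok.
(* A dual tensor has one distinguished upper tree; the first is chosen, and is present even in the
   word with no letter. *)
rewrite /vals map_cons; set p := reify v.1; set ps := map _ (unzip2 v.2).
suff -> : omega K k n (letters v) (p :: ps) =
    ctensor n (wvect K k.+1 (letters v)) [::] (fvec K (leaves p) p) ps.
  apply/spanp_gen/DualTensor; first by rewrite !size_map.
  by apply: wvect_koszul_dual; rewrite ?size_letters.
rewrite /omega /ctensor; apply: eq_bigr => t _.
under [RHS]eq_bigr => q _ do rewrite -scalerA.
by rewrite -scaler_sumr (sum_bvec (ntree E (leaves p)) (fun q => cvec K k n (plug t (q :: ps)))).
Qed.

Lemma map_reify_mrg (e : E) i (xs : seq (evtree gamma)) :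
  map (@reify gamma) (mrg (act e) i xs) = map nf (mrg (Node e) i (map (@reify gamma) xs)).
Proof.
have nf_reify x : nf (reify x) = reify x by rewrite /nf reifyK.
elim: xs i => [|x [|y xs] IH] [|i] //=; rewrite ?nf_reify //.
  rewrite /nf /= !reifyK; congr (_ :: _).
  by rewrite -map_comp; apply: eq_map => z /=; rewrite reifyK.
by congr (_ :: _); exact: IH.
Qed.

(** The square commutes only modulo the ideal: the differential creates an upper tree [Node e p q],
    whereas a merge of words takes its normal form. *)
Lemma kdiff0_omega_map k n (X : Free2 K E k.+1 n) : X \in spanp (@is_word k.+1 n) ->
  kdiff0 (omega_map X) - omega_map (dmap X) \in ideal k n.
Proof.
pose f := ((linfun (@kdiff0 K E k n) \o linfun (@omega_map k.+1 n)) -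
           (linfun (@omega_map k n) \o linfun (@dmap k n)))%VF.
have fE x : f x = kdiff0 (omega_map x) - omega_map (dmap x) by rewrite /f !lfun_simp.
rewrite -fE; apply: (spanp_lin (f := f)) => _ [v vok ->]; rewrite /= fE.
have /and3P[gv /eqP szv _] := vok.
have [e0 _] : exists e0 : E, e0 \in letters v.
  by case: (letters v) (size_letters v) => [|e l _]; [rewrite szv | exists e; rewrite mem_head].
rewrite omega_wvec // (kdiff0_omega _ _ e0) ?size_letters ?size_map ?size_vals ?szv //.
rewrite dmap_wvec // (linear_sum (@omega_map k n)) /= -sumrB; apply: spanp_sum => i /=.
rewrite linearZ /= -scalerBr; apply: spanpZ; rewrite omega_wvec ?wok_merge //.
have iv : (i < size v.2)%N by rewrite szv.
rewrite letters_merge //; set ps := mrg _ _ _.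
have -> : map (@reify gamma) (vals (merge_word i v)) = map nf ps.
  by rewrite (vals_merge e0) // map_reify_mrg.
apply: omega_nf.
have szp : size (map (@reify gamma) (vals v)) = k.+2 by rewrite size_map size_vals szv.
by rewrite /ps size_mrg szp // ltnS ltn_ord.
Qed.

Lemma dup_koszul : koszul (dup_rel K gamma).
Proof.
move=> n k x n1 [y dual_y ->{x}] cycle_y.
have yX := dual_psi dual_y; set X := psi_map y in yX.
have wX : X \in spanp (@is_word k n) by exact: psi_word.
have DX : dmap (hmap X) = X.
  case: k y dual_y cycle_y X yX wX => [|k] y dual_y cycle_y X yX wX; first exact: homotopy0.
  have Iy : kdiff0 y \in ideal k n.
    by move/eqP: cycle_y; rewrite /koszul_cycle kdiffE /cpi quot_pi_eq0.
  (* Applying [psi_map] to this membership gives [dmap X = 0], because [psi_map] kills the ideal and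
     undoes [omega_map]; the homotopy formula then reduces to [dmap (hmap X) = X]. *)
  have IX : omega_map (dmap X) \in ideal k n.
    rewrite -[omega_map _](subKr (kdiff0 (omega_map X))) spanpB ?kdiff0_omega_map //.
    rewrite -[kdiff0 (omega_map X)](subKr (kdiff0 y)) spanpB // -linearB.
    exact: kdiff0_ideal.
  have := homotopyS n1 wX; rewrite -(psi_omega_map (dmap_word wX)) (psi_ideal IX).
  by rewrite linear0 addr0.
have wH := hmap_word n1 wX.
exists (cpi (dup_rel K gamma) (omega_map (hmap X))).
  by exists (omega_map (hmap X)) => //; exact: omega_map_dual.
rewrite kdiffE; apply/eqP; rewrite -subr_eq0 /cpi -linearB quot_pi_eq0.
rewrite -(subrKA (omega_map X)) spanpD //; last by rewrite -opprB spanpN.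
by rewrite -{2}DX kdiff0_omega_map.
Qed.

End Complex.

Theorem proposition6p1p2 (K : fieldType) (charK : [pchar K] =i pred0) (gamma : nat) :
  koszul (dup_rel K gamma) /\
  (forall n : nat, (1 <= n)%N ->
     exists f : {linear Dup K gamma n -> EvSpace K gamma n}, bijective f).
Proof.
split=> [|n _]; first exact: dup_koszul.
exists (@dup_iso K gamma n); exact: dup_iso_bij.
Qed.
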